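(* Let $A=A^0\oplus A^1$ be a commutative superalgebra over a field of characteristic $0$. For every linear operator $f\colon A\to A$ one has $\Phi^1_f=f$ and, for every $n\ge 1$, $$\Phi^{n+1}_f=\frac1n\sum_{h=1}^n(-1)^h\rho_h\big(\Phi^{n-h+1}_f\big)=\frac{1}{n}\sum_{h=1}^n(-1)^{h}\big[\mu_h,\Phi^{n-h+1}_f\big].$$
   Context: Superalgebras are associative and $\mathbb{Z}/2$-graded, not necessarily unital; $|a|\in\{0,1\}$ is the parity of a homogeneous element $a$, and commutative means $ab=(-1)^{|a||b|}ba$. Linear operators may be even, odd, or sums of both. Shuffles and signs: $S(p,q)$ is the set of permutations $\sigma$ of $p+q$ ordered indices that are increasing on the first $p$ indices and on the last $q$ indices. The Koszul sign of $\sigma$ with respect to homogeneous elements $a_1,\dots,a_n$ is $\epsilon(\sigma)=(-1)^\alpha$, where $\alpha$ is the number of pairs $i<j$ with $\sigma(i)>\sigma(j)$ and $|a_{\sigma(i)}||a_{\sigma(j)}|=1$. Higher antibrackets: for $f\colon A\to A$ linear and $n\ge 1$, $\Phi^n_f\colon A^{\odot n}\to A$ is $$\Phi^n_f(a_1,\ldots,a_n)=\sum_{k=1}^n(-1)^{n-k}\sum_{\sigma\in S(k,n-k)}\epsilon(\sigma)\,f(a_{\sigma(1)}\cdots a_{\sigma(k)})\,a_{\sigma(k+1)}\cdots a_{\sigma(n)}.$$ $D_n(A)=\mathrm{Hom}^*(A^{\odot n+1},A)$ is the super vector space of all (even and odd) supersymmetric multilinear maps in $n+1$ variables; $D(A)=\prod_{n\ge0}D_n(A)$.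 For $f\in D_n(A)$, $g\in D_m(A)$ put $$(f\barwedge g)(v_0,\ldots,v_{n+m})=\sum_{\sigma\in S(m+1,n)}\epsilon(\sigma)\,f\big(g(v_{\sigma(0)},\ldots,v_{\sigma(m)}),v_{\sigma(m+1)},\ldots,v_{\sigma(m+n)}\big),$$ and $[f,g]=f\barwedge g-(-1)^{|f||g|}g\barwedge f\in D_{n+m}(A)$ (Nijenhuis–Richardson bracket), extended componentwise to $D(A)$. Multiplication operators: $\mu_n\in D_n(A)$, $\mu_n(a_0,\ldots,a_n)=a_0a_1\cdots a_n$; and $\rho_n\colon D(A)\to D(A)$, $\rho_n(\omega)=[\mu_n,\omega]$. *)

(* Defs.v *)
From HB Require Import structures.
From mathcomp Require Import all_boot all_order all_algebra all_fingroup.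
From mathcomp Require Import boolp zify.
Set Implicit Arguments.
Unset Strict Implicit.
Unset Printing Implicit Defensive.
Import GRing.Theory.
Local Open Scope ring_scope.

(* Parities are booleans: [false] is even, [true] is odd, and parities add
   with [(+)].  The zero vector is homogeneous of both parities.              *)
HB.mixin Record Lmodule_isSuper (k : fieldType) V & GRing.Lmodule k V := {
  homog : bool -> {pred V};
  homog_closed : forall s, submod_closed (homog s);
  homog_split : forall v : V, exists v0 v1,
    [/\ v0 \in homog false, v1 \in homog true & v = v0 + v1];
  homog_direct : forall v : V, v \in homog false -> v \in homog true -> v = 0
}.

#[short(type="superModType")]
HB.structure Definition SuperModule (k : fieldType) :=
  {V of Lmodule_isSuper k V & GRing.Lmodule k V}.

(* No unit is required. *)
HB.mixin Record SuperModule_isSuperAlgebra (k : fieldType) A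
    & SuperModule k A := {
  smul : A -> A -> A;
  smul_linear_l : forall b : A, linear (smul^~ b);
  smul_linear_r : forall a : A, linear (smul a);
  smulA : associative smul;
  smul_homog : forall (s t : bool) (a b : A),
    a \in homog s -> b \in homog t -> smul a b \in homog (s (+) t)
}.

#[short(type="superAlgType")]
HB.structure Definition SuperAlgebra (k : fieldType) :=
  {A of SuperModule_isSuperAlgebra k A & SuperModule k A}.

HB.mixin Record SuperAlgebra_isCommutative (k : fieldType) A
    & SuperAlgebra k A := {
  smulC : forall (s t : bool) (a b : A), a \in homog s -> b \in homog t ->
    smul a b = (-1) ^+ (s && t) *: smul b a
}.

#[short(type="comSuperAlgType")]
HB.structure Definition ComSuperAlgebra (k : fieldType) :=
  {A of SuperAlgebra_isCommutative k A & SuperAlgebra k A}.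

Section SuperPart.
Variables (k : fieldType) (V : superModType k).
Implicit Types (v w : V) (s : bool).

Lemma homog0 s : (0 : V) \in homog s.
Proof. by have [] := @homog_closed k V s. Qed.

Lemma homogP s a v w : v \in homog s -> w \in homog s -> a *: v + w \in homog s.
Proof. by have [_] := @homog_closed k V s; apply. Qed.

Lemma homogB s v w : v \in homog s -> w \in homog s -> v - w \in homog s.
Proof. by move=> hv hw; rewrite addrC -scaleN1r homogP. Qed.

Lemma superpart_subproof s v :
  exists w, (w \in homog s) && (v - w \in homog (~~ s)).
Proof.
have [v0 [v1 [h0 h1 ->]]] := homog_split v.
case: s; first by exists v1; rewrite h1 addrK.
by exists v0; rewrite h0 addrC addKr.
Qed.

(* The component of [v] of parity [s]; the choice is unique. *)
Definition superpart s v : V := xchoose (superpart_subproof s v).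

Lemma superpart_homog s v : superpart s v \in homog s.
Proof. by have /andP[] := xchooseP (superpart_subproof s v). Qed.

Lemma superpart_unique s v w :
  w \in homog s -> v - w \in homog (~~ s) -> superpart s v = w.
Proof.
move=> hw hvw; have /andP[hp hvp] := xchooseP (superpart_subproof s v).
rewrite -/(superpart s v) in hp hvp.
apply/eqP; rewrite -subr_eq0; apply/eqP.
have h1 := homogB hp hw; have h2 := homogB hvw hvp.
rewrite opprB addrC addrA subrK addrC addrC in h2.
by case: s hw hvw hp hvp h1 h2 => *; apply: homog_direct.
Qed.

Lemma superpart_id s v : v \in homog s -> superpart s v = v.
Proof. by move=> hv; apply: superpart_unique; rewrite // subrr homog0. Qed.

Lemma superpart_neq s t v : v \in homog t -> s != t -> superpart s v = 0.
Proof.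
move=> hv nst; apply: superpart_unique; rewrite ?homog0 // subr0.
by case: s t nst hv => [] [].
Qed.

Lemma superpart_linear s : linear (superpart s).
Proof.
move=> a v w; apply: superpart_unique.
  by apply: homogP; apply: superpart_homog.
have h u := andP (xchooseP (superpart_subproof s u)).
rewrite opprD addrACA -scalerBr; apply: homogP; first by case: (h v).
by case: (h w).
Qed.

End SuperPart.

HB.instance Definition _ (k : fieldType) (V : superModType k) s :=
  GRing.isLinear.Build k V V _ (@superpart k V s) (superpart_linear s).

(* S(j, n - j): increasing on the first j and on the last n - j indices. *)
Definition shuffles (n j : nat) : {set 'S_n} :=
  [set s : 'S_n | [forall a : 'I_n, forall b : 'I_n,
     (a < b)%N && ((b < j) || (j <= a))%N ==> (s a < s b)%N]].

Definition koszul_inv n (p : {ffun 'I_n -> bool}) (s : 'S_n) :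
    {set 'I_n * 'I_n} :=
  [set ab : 'I_n * 'I_n | [&& (ab.1 < ab.2)%N, (s ab.2 < s ab.1)%N,
                p (s ab.1) & p (s ab.2)]].

Section Shuffles.
Variable n : nat.
Implicit Types s t y : 'S_n.

Definition blockperm (j : nat) (y : 'S_n) :=
  [forall a : 'I_n, (y a < j)%N == (a < j)%N].

Definition adj_inv (T : eqType) (j : nat) (G : 'S_n -> T) :=
  forall s (a b : 'I_n), b = a.+1 :> nat -> ((b < j) || (j <= a))%N ->
    G (tperm a b * s)%g = G s.

Lemma blockpermM j y z :
  blockperm j y -> blockperm j z -> blockperm j (y * z)%g.
Proof.
move=> /forallP hy /forallP hz; apply/forallP=> a; rewrite permM.
by rewrite (eqP (hz _)) (eqP (hy _)).
Qed.

Lemma blockpermV j y : blockperm j y -> blockperm j y^-1%g.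
Proof.
move=> /forallP hy; apply/forallP=> a.
by rewrite -(eqP (hy _)) permKV.
Qed.

Lemma blockperm1 j : blockperm j 1%g.
Proof. by apply/forallP=> a; rewrite perm1. Qed.

Lemma blockperm_tperm j (a b : 'I_n) : b = a.+1 :> nat ->
  ((b < j) || (j <= a))%N -> blockperm j (tperm a b).
Proof.
move=> ab bj; apply/forallP=> c.
case: tpermP => [->|->|_ _]; rewrite ?eqxx //; apply/eqP; apply/idP/idP; lia.
Qed.

Lemma shufflesP j s :
  reflect (forall a b : 'I_n, (a < b)%N -> ((b < j) || (j <= a))%N ->
             (s a < s b)%N) (s \in shuffles n j).
Proof.
rewrite inE; apply: (iffP forallP) => [h a b ab hj | h a].
  by have /forallP/(_ b) := h a; rewrite ab hj.
by apply/forallP => b; apply/implyP => /andP[ab hj]; apply: h.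
Qed.

Lemma shuffle_adj j s :
  (forall a b : 'I_n, b = a.+1 :> nat -> ((b < j) || (j <= a))%N ->
     (s a < s b)%N) -> s \in shuffles n j.
Proof.
move=> h; apply/shufflesP => a b ab.
have [d] : exists d, d = (b - a)%N by eexists.
elim: d b ab => [|d IH] b ab hd hj; first lia.
have [e|ne] := eqVneq (b : nat) a.+1; first exact: h.
have hb : (b.-1 < n)%N by have := ltn_ord b; lia.
apply: (@ltn_trans (s (Ordinal hb))); first by apply: IH => /=; lia.
by apply: h => /=; lia.
Qed.

Lemma shuffle_exists (T : eqType) j (G : 'S_n -> T) s : adj_inv j G ->
  exists y, [/\ blockperm j y, (y * s)%g \in shuffles n j &
                G (y * s)%g = G s].
Proof.
move=> Ginv.
pose P y := blockperm j y && (G (y * s)%g == G s).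
pose M (y : 'S_n) := (\sum_(i < n) i * (y * s)%g i)%N.
have P1 : P 1%g by rewrite /P blockperm1 mul1g eqxx.
case: (arg_maxnP M P1) => y /andP[yb /eqP yG] ymax.
exists y; split=> //; apply: shuffle_adj => a b ab hj.
have nab : a != b by rewrite -val_eqE /=; lia.
have Pt : P (tperm a b * y)%g.
  rewrite /P blockpermM ?(blockperm_tperm ab hj) //=.
  by rewrite -mulgA (Ginv _ _ _ ab hj) yG.
have ME (z : 'S_n) : M z = (a * (z * s)%g a + (b * (z * s)%g b +
    \sum_(i | (i != a) && (i != b)) i * (z * s)%g i))%N.
  by rewrite /M (bigD1 a) //= (bigD1 b) //= eq_sym.
have := ymax _ Pt; rewrite /= !ME -mulgA !(permM (tperm a b)) tpermL tpermR.
rewrite (eq_bigr (fun i : 'I_n => i * (y * s)%g i)%N); last first.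
  by move=> i /andP[ia ib]; rewrite permM tpermD // eq_sym.
have : (y * s)%g a != (y * s)%g b :> nat by rewrite val_eqE (inj_eq perm_inj).
set u := nat_of_ord ((y * s)%g a); set w := nat_of_ord ((y * s)%g b).
set S := (\sum_(_ | _) _)%N.
rewrite ab !mulSn => /eqP nuw.
by move: (a * u)%N (a * w)%N => x y' /= hle; lia.
Qed.

Lemma shuffle_unique j y s : blockperm j y -> s \in shuffles n j ->
  (y * s)%g \in shuffles n j -> y = 1%g.
Proof.
move=> yb /shufflesP hs /shufflesP hys.
have ybE a : (y a < j)%N = (a < j)%N by move/forallP: yb => /(_ a)/eqP.
have ymono (a b : 'I_n) : (a < b)%N -> ((b < j) || (j <= a))%N ->
    (y a < y b)%N.
  move=> ab hj; have := hys _ _ ab hj; rewrite !permM => hlt.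
  rewrite ltnNge leq_eqVlt; apply/negP => /orP[/eqP/val_inj/perm_inj e|hl].
    by rewrite e ltnn in ab.
  have := hs _ _ hl; have := ybE a; have := ybE b => ea eb /(_ ltac:(lia)).
  lia.
apply/permP => a; rewrite perm1.
have [m] : exists m, m = (a : nat) by eexists.
elim/ltn_ind: m a => m IH a em; apply/val_inj.
have fixlt (b : 'I_n) : (b < a)%N -> y b = b by move=> h; apply: (IH b); lia.
case: (ltngtP (y a) a) => // h.
  by have /perm_inj e := fixlt _ h; rewrite e ltnn in h.
pose c := (y^-1%g a); have yc : y c = a by rewrite permKV.
have nca : c != a by apply/eqP => e; rewrite e in yc; rewrite yc ltnn in h.
have hc : (a < c)%N.
  case: (ltngtP a c) => // [/fixlt e|/val_inj e]; last by rewrite e eqxx in nca.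
  by rewrite -e yc eqxx in nca.
have := ymono a c hc; rewrite yc; have := ybE c; rewrite yc; lia.
Qed.

Lemma adj_inv_const (T : eqType) (G : 'S_n -> T) s :
  adj_inv n G -> G s = G 1%g.
Proof.
move=> Ginv; have [y [_ ys <-]] := shuffle_exists s Ginv.
congr G; apply: (@shuffle_unique n _ 1%g); last by rewrite mulg1.
  by apply/forallP => a; rewrite !ltn_ord.
by apply/shufflesP => a b; rewrite !perm1.
Qed.

Lemma sum_shuffles_mulr (V : zmodType) j (G : 'S_n -> V) t : adj_inv j G ->
  \sum_(s in shuffles n j) G (s * t)%g = \sum_(s in shuffles n j) G s.
Proof.
move=> Ginv.
pose good s r := [&& r \in shuffles n j, blockperm j (r * s^-1)%g & G r == G s].
have goodP s : exists r, good s r.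
  have [y [yb ys yG]] := shuffle_exists s Ginv.
  by exists (y * s)%g; rewrite /good ys mulgK yb yG eqxx.
pose r s := xchoose (goodP s).
have rP s : good s (r s) := xchooseP (goodP s).
pose h s := r (s * t)%g.
have hinj : {in shuffles n j &, injective h}.
  move=> s s' hs hs' e.
  have /and3P[_ b1 _] := rP (s * t)%g; have /and3P[_ b2 _] := rP (s' * t)%g.
  have := blockpermM (blockpermV b1) b2; rewrite -/(h s) -/(h s') e.
  rewrite !invMg !invgK !mulgA mulgKV mulgK => b.
  have := @shuffle_unique j _ s' b hs'; rewrite mulgKV => /(_ hs) e1.
  by apply/eqP; rewrite eq_mulgV1 e1.
have him : h @: shuffles n j = shuffles n j.
  apply/eqP; rewrite eqEcard card_in_imset // leqnn andbT.
  by apply/subsetP => _ /imsetP[s _ ->]; have /and3P[] := rP (s * t)%g.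
rewrite -[in RHS]him big_imset //=; apply: eq_bigr => s _.
by have /and3P[_ _ /eqP] := rP (s * t)%g.
Qed.

End Shuffles.

Section KoszulSign.
Variables (k : fieldType) (n : nat).
Implicit Types (p : {ffun 'I_n -> bool}) (s t : 'S_n).

(* [p i] is the parity of the i-th element. *)
Definition koszul p s : k := (-1) ^+ #|koszul_inv p s|.

Lemma koszul1 p : koszul p 1%g = 1.
Proof.
rewrite /koszul (_ : koszul_inv _ _ = set0) ?cards0 //.
by apply/setP => -[a b]; rewrite !inE /= !perm1; apply/negP; lia.
Qed.

Lemma koszul_sq p s : koszul p s * koszul p s = 1.
Proof. by rewrite -expr2 sqrr_sign. Qed.

Lemma koszul_adj p s (a b : 'I_n) : b = a.+1 :> nat ->
  koszul p (tperm a b * s)%g = (-1) ^+ (p (s a) && p (s b)) * koszul p s.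
Proof.
move=> ab; rewrite /koszul.
have nab : a != b by rewrite -val_eqE /=; lia.
pose f (xy : 'I_n * 'I_n) := (tperm a b xy.1, tperm a b xy.2).
have finj : injective f by move=> [x y] [x' y'] [/perm_inj-> /perm_inj->].
have tlt (x y : 'I_n) : (x < y)%N -> (x, y) != (a, b) ->
    (tperm a b x < tperm a b y)%N.
  rewrite xpair_eqE -!val_eqE /= => xy nxy.
  case: tpermP nxy xy => [->|->|/eqP]; case: tpermP => [->|->|/eqP];
    rewrite -?val_eqE /=; lia.
have tab (x y : 'I_n) : (x < y)%N ->
    (tperm a b x, tperm a b y) != (a, b).
  rewrite xpair_eqE -!val_eqE /=.
  case: tpermP => [->|->|/eqP]; case: tpermP => [->|->|/eqP];
    rewrite -?val_eqE /=; lia.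
have E : #|koszul_inv p (tperm a b * s)%g :\ (a, b)| =
         #|koszul_inv p s :\ (a, b)|.
  rewrite -(card_imset _ finj); apply: eq_card => -[x y].
  have -> : (x, y) = f (tperm a b x, tperm a b y) by rewrite /f /= !tpermK.
  rewrite (mem_imset _ _ finj) !inE /f /= !permM !tpermK.
  apply/idP/idP => /and5P[h1 h2 -> -> ->]; rewrite !andbT.
    have := tlt _ _ h2 h1; rewrite !tpermK => h3; rewrite h3 andbT.
    by have := tab _ _ h2; rewrite !tpermK.
  by rewrite tlt // tab.
rewrite (cardsD1 (a, b)) [in RHS](cardsD1 (a, b)) E !exprD mulrA.
congr (_ * _); rewrite !inE /= !permM tpermL tpermR ab leqnn /=.
have : s a != s b :> nat by rewrite val_eqE (inj_eq perm_inj).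
case: (p _); case: (p _); rewrite /= ?andbF ?mul1r //.
by case: ltngtP; rewrite //= !expr0 !expr1 ?mulr1 ?mulrNN ?mulr1.
Qed.

Lemma koszulM p s t :
  koszul p (s * t)%g = koszul p t * koszul [ffun i => p (t i)] s.
Proof.
pose G s := koszul p (s * t)%g * koszul [ffun i => p (t i)] s.
have Ginv : adj_inv n G.
  move=> r a b ab _; rewrite /G -mulgA !koszul_adj // !ffunE !permM mulrACA.
  by rewrite -expr2 sqrr_sign mul1r.
have := adj_inv_const s Ginv; rewrite /G mul1g koszul1 mulr1 => <-.
by rewrite -mulrA koszul_sq mulr1.
Qed.

End KoszulSign.

Section Multilinear.
Variables (k : fieldType) (V : superModType k).

Definition upd n (v : {ffun 'I_n -> V}) (i : 'I_n) (x : V) : {ffun 'I_n -> V} :=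
  [ffun j => if j == i then x else v j].

Definition multilinear n (f : {ffun 'I_n -> V} -> V) :=
  forall (v : {ffun 'I_n -> V}) (i : 'I_n), linear (fun x => f (upd v i x)).

Definition supersymmetric n (f : {ffun 'I_n -> V} -> V) :=
  forall (p : {ffun 'I_n -> bool}) (v : {ffun 'I_n -> V}),
    (forall i, v i \in homog (p i)) ->
  forall s : 'S_n, f v = koszul k p s *: f [ffun i => v (s i)].

(* Hom^*(V^{(.) n}, V), with both even and odd maps. *)
Record symmap n := Symmap {
  symfun :> {ffun 'I_n -> V} -> V;
  symmap_multilinear : multilinear symfun;
  symmap_supersym : supersymmetric symfun
}.

Lemma symmap_ext n (f g : symmap n) : (forall v, f v = g v) -> f = g.
Proof.
case: f g => [f f1 f2] [g g1 g2] /= /funext e; subst g.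
by congr Symmap; apply: Prop_irrelevance.
Qed.

HB.instance Definition _ n := gen_eqMixin (symmap n).
HB.instance Definition _ n := gen_choiceMixin (symmap n).

Section Operations.
Variable n : nat.
Implicit Types f g h : symmap n.

Lemma symmap0_subproof :
  multilinear (fun _ : {ffun 'I_n -> V} => 0) /\
  supersymmetric (fun _ : {ffun 'I_n -> V} => 0).
Proof.
split=> [v i a x y|p v hv s]; by rewrite scaler0 ?addr0.
Qed.
Definition symmap0 : symmap n :=
  Symmap (proj1 symmap0_subproof) (proj2 symmap0_subproof).

Lemma symmapD_subproof f g :
  multilinear (fun v => f v + g v) /\ supersymmetric (fun v => f v + g v).
Proof.
split=> [v i a x y|p v hv s].
  by rewrite !symmap_multilinear scalerDr addrACA.
by rewrite (symmap_supersym f hv s) (symmap_supersym g hv s) scalerDr.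
Qed.
Definition symmapD f g : symmap n :=
  Symmap (proj1 (symmapD_subproof f g)) (proj2 (symmapD_subproof f g)).

Lemma symmapZ_subproof (c : k) f :
  multilinear (fun v => c *: f v) /\ supersymmetric (fun v => c *: f v).
Proof.
split=> [v i a x y|p v hv s].
  by rewrite symmap_multilinear scalerDr !scalerA mulrC.
by rewrite (symmap_supersym f hv s) !scalerA mulrC.
Qed.
Definition symmapZ (c : k) f : symmap n :=
  Symmap (proj1 (symmapZ_subproof c f)) (proj2 (symmapZ_subproof c f)).

Definition symmapN f : symmap n := symmapZ (-1) f.

Lemma symmapDA : associative symmapD.
Proof. by move=> f g h; apply: symmap_ext => v /=; rewrite addrA. Qed.
Lemma symmapDC : commutative symmapD.
Proof. by move=> f g; apply: symmap_ext => v /=; rewrite addrC. Qed.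
Lemma symmap0D : left_id symmap0 symmapD.
Proof. by move=> f; apply: symmap_ext => v /=; rewrite add0r. Qed.
Lemma symmapND : left_inverse symmap0 symmapN symmapD.
Proof. by move=> f; apply: symmap_ext => v /=; rewrite scaleN1r addNr. Qed.

End Operations.

HB.instance Definition _ n := GRing.isZmodule.Build (symmap n)
  (@symmapDA n) (@symmapDC n) (@symmap0D n) (@symmapND n).

Section Scaling.
Variable n : nat.
Implicit Types f g h : symmap n.

Lemma symmapZA a b f : symmapZ a (symmapZ b f) = symmapZ (a * b) f.
Proof. by apply: symmap_ext => v /=; rewrite scalerA. Qed.
Lemma symmap1Z : left_id 1 (@symmapZ n).
Proof. by move=> f; apply: symmap_ext => v /=; rewrite scale1r. Qed.
Lemma symmapZDr : right_distributive (@symmapZ n) +%R.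
Proof. by move=> a f g; apply: symmap_ext => v /=; rewrite scalerDr. Qed.
Lemma symmapZDl f : {morph (@symmapZ n)^~ f : a b / a + b}.
Proof. by move=> a b; apply: symmap_ext => v /=; rewrite scalerDl. Qed.

End Scaling.

HB.instance Definition _ n := GRing.Zmodule_isLmodule.Build k (symmap n)
  (@symmapZA n) (@symmap1Z n) (@symmapZDr n) (@symmapZDl n).

Section Theory.
Variable n : nat.
Implicit Types (f g : symmap n) (v : {ffun 'I_n -> V}).

Lemma symmap_addE f g v : (f + g) v = f v + g v. Proof. by []. Qed.
Lemma symmap_scaleE a f v : (a *: f) v = a *: f v. Proof. by []. Qed.
Lemma symmap_zeroE v : (0 : symmap n) v = 0. Proof. by []. Qed.
Lemma symmap_oppE f v : (- f) v = - f v.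
Proof. exact: scaleN1r. Qed.
Lemma symmap_sumE I r (P : pred I) (F : I -> symmap n) v :
  (\sum_(i <- r | P i) F i) v = \sum_(i <- r | P i) F i v.
Proof. by elim/big_rec2: _ => // i y g _ <-. Qed.

Lemma multilinear0 (F : {ffun 'I_n -> V} -> V) v i :
  multilinear F -> v i = 0 -> F v = 0.
Proof.
move=> Flin vi0; have -> : v = upd v i 0.
  by apply/ffunP => j; rewrite ffunE; case: eqP => // ->.
by have := Flin v i (-1) 0 0; rewrite scaler0 addr0 scaleN1r addNr.
Qed.

Lemma upd_perm v i x (s : 'S_n) :
  [ffun a => upd v i x (s a)] = upd [ffun a => v (s a)] (s^-1%g i) x.
Proof.
apply/ffunP => a; rewrite !ffunE; congr (if _ then _ else _).
by apply/eqP/eqP => [<-|->]; rewrite ?permK ?permKV.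
Qed.

Lemma multilinear_perm (F : {ffun 'I_n -> V} -> V) (s : 'S_n) :
  multilinear F -> multilinear (fun v => F [ffun a => v (s a)]).
Proof. by move=> Flin v i a x y; rewrite !upd_perm Flin. Qed.

Lemma multilinear_sum I r (P : pred I) (F : I -> {ffun 'I_n -> V} -> V) :
  (forall i, multilinear (F i)) ->
  multilinear (fun v => \sum_(i <- r | P i) F i v).
Proof.
move=> Flin v i a x y; rewrite scaler_sumr -big_split /=.
by apply: eq_bigr => j _; rewrite Flin.
Qed.

Lemma multilinear_scale c (F : {ffun 'I_n -> V} -> V) :
  multilinear F -> multilinear (fun v => c *: F v).
Proof. by move=> Flin v i a x y; rewrite Flin scalerDr !scalerA mulrC. Qed.

Lemma multilinear_comp (h : {linear V -> V}) (F : {ffun 'I_n -> V} -> V) :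
  multilinear F -> multilinear (fun v => h (F v)).
Proof. by move=> Flin v i a x y; rewrite Flin linearP. Qed.

(* The multilinear extension of a formula [F p v] that is meaningful when
   each [v i] is homogeneous of parity [p i].                                *)
Definition homog_extend (F : {ffun 'I_n -> bool} -> {ffun 'I_n -> V} -> V) v :=
  \sum_(p : {ffun 'I_n -> bool}) F p [ffun i => superpart (p i) (v i)].

Lemma homog_extend_multilinear F :
  (forall p, multilinear (F p)) -> multilinear (homog_extend F).
Proof.
move=> Flin; apply: multilinear_sum => p v i a x y.
have E z : [ffun j => superpart (p j) (upd v i z j)] =
           upd [ffun j => superpart (p j) (v j)] i (superpart (p i) z).
  by apply/ffunP => j; rewrite !ffunE; case: eqP => // ->.
by rewrite !E linearP Flin.
Qed.

Lemma homog_extendE F (p : {ffun 'I_n -> bool}) v :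
  (forall p, multilinear (F p)) -> (forall i, v i \in homog (p i)) ->
  homog_extend F v = F p v.
Proof.
move=> Flin hv; rewrite /homog_extend (bigD1 p) //= big1 ?addr0.
  by congr F; apply/ffunP => i; rewrite ffunE superpart_id.
move=> q nqp; have [i ni] : exists i, q i != p i.
  apply/existsP; apply: contraNT nqp; rewrite negb_exists => /forallP h.
  by apply/eqP/ffunP => i; apply/eqP; rewrite -[_ == _]negbK.
by apply: (multilinear0 (i := i)) => //; rewrite ffunE (superpart_neq (hv i)).
Qed.

Definition block_supersym (j : nat) (T : {ffun 'I_n -> V} -> V) :=
  forall (p : {ffun 'I_n -> bool}) v, (forall i, v i \in homog (p i)) ->
  forall a b : 'I_n, b = a.+1 :> nat -> ((b < j) || (j <= a))%N ->
    T [ffun i => v (tperm a b i)] = (-1) ^+ (p a && p b) *: T v.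

Lemma block_adj_inv j T (p : {ffun 'I_n -> bool}) v :
  block_supersym j T -> (forall i, v i \in homog (p i)) ->
  adj_inv j (fun s : 'S_n => koszul k p s *: T [ffun i => v (s i)]).
Proof.
move=> Tsym hv r a b ab hj; rewrite koszul_adj //.
pose q := [ffun i => p (r i)]; pose w := [ffun i => v (r i)].
have hw i : w i \in homog (q i) by rewrite !ffunE.
have -> : [ffun i => v ((tperm a b * r)%g i)] = [ffun i => w (tperm a b i)].
  by apply/ffunP => i; rewrite !ffunE permM.
rewrite (Tsym _ _ hw _ _ ab hj) scalerA mulrAC !ffunE.
by rewrite -expr2 sqrr_sign mul1r.
Qed.

Lemma block_supersym_full T : block_supersym n T -> supersymmetric T.
Proof.
move=> Tsym p v hv s; have := adj_inv_const s (block_adj_inv Tsym hv).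
rewrite koszul1 scale1r => ->; congr T.
by apply/ffunP => i; rewrite ffunE perm1.
Qed.

(* Sum over S(j, n - j) of (Koszul sign) * T(v_sigma), on homogeneous
   arguments, extended multilinearly.                                       *)
Definition shuffle_sum (j : nat) (T : {ffun 'I_n -> V} -> V) :=
  homog_extend (fun p v =>
    \sum_(s in shuffles n j) koszul k p s *: T [ffun i => v (s i)]).

Lemma shuffle_sum_subproof j T : multilinear T -> block_supersym j T ->
  multilinear (shuffle_sum j T) /\ supersymmetric (shuffle_sum j T).
Proof.
move=> Tlin Tsym.
have Flin p : multilinear (fun v =>
    \sum_(s in shuffles n j) koszul k p s *: T [ffun i => v (s i)]).
  apply: multilinear_sum => s; apply: multilinear_scale.
  exact: multilinear_perm.
split; first exact: homog_extend_multilinear.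
move=> p v hv t; pose q := [ffun i => p (t i)].
have hw i : [ffun i => v (t i)] i \in homog (q i) by rewrite !ffunE.
rewrite /shuffle_sum (homog_extendE Flin hv) (homog_extendE Flin hw).
rewrite -(sum_shuffles_mulr t (block_adj_inv Tsym hv)) scaler_sumr.
apply: eq_bigr => s _.
rewrite koszulM scalerA; congr (_ *: T _).
by apply/ffunP => i; rewrite !ffunE permM.
Qed.

Definition shuffle_symmap j T (Tlin : multilinear T)
    (Tsym : block_supersym j T) : symmap n :=
  Symmap (proj1 (shuffle_sum_subproof Tlin Tsym))
         (proj2 (shuffle_sum_subproof Tlin Tsym)).

(* The component of parity [s] of [f]: it sends homogeneous arguments to the
   component of f(v) whose parity is [s] plus the parities of the arguments. *)
Definition sympart_fun (s : bool) f :=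
  homog_extend (fun p v =>
    superpart (s (+) \big[addb/false]_(i < n) p i) (f v)).

Lemma sympart_subproof s f :
  multilinear (sympart_fun s f) /\ supersymmetric (sympart_fun s f).
Proof.
have Flin (p : {ffun 'I_n -> bool}) : multilinear (fun v =>
    superpart (s (+) \big[addb/false]_(i < n) p i) (f v)).
  by apply: multilinear_comp; apply: symmap_multilinear.
split; first exact: homog_extend_multilinear.
move=> p v hv t; pose q := [ffun i => p (t i)].
have hw i : [ffun i => v (t i)] i \in homog (q i) by rewrite !ffunE.
rewrite /sympart_fun (homog_extendE Flin hv) (homog_extendE Flin hw).
rewrite (symmap_supersym f hv t) linearZ /=; congr (_ *: superpart (_ (+) _) _).
rewrite (reindex_inj (@perm_inj _ t)) /=.
by apply: eq_bigr => i _; rewrite ffunE.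
Qed.

Definition sympart s f : symmap n :=
  Symmap (proj1 (sympart_subproof s f)) (proj2 (sympart_subproof s f)).

End Theory.
End Multilinear.

(* D_n(V): supersymmetric multilinear maps in n + 1 variables. *)
Notation superD V n := (symmap V n.+1).

Section AdjacentSwaps.
Variables (k : fieldType) (V : superModType k).

Lemma superpart_split (v : V) : v = superpart false v + superpart true v.
Proof.
have [v0 [v1 [h0 h1 ->]]] := homog_split v; rewrite !linearD /=.
rewrite (superpart_id h0) (superpart_id h1).
by rewrite (superpart_neq h1) // (superpart_neq h0) // addr0 add0r.
Qed.

Lemma multilinearZ n (F : {ffun 'I_n -> V} -> V) v i c x :
  multilinear F -> F (upd v i (c *: x)) = c *: F (upd v i x).
Proof.
move=> Flin; have := Flin v i c x 0; rewrite addr0 => ->.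
by rewrite (multilinear0 (v := upd v i 0) (i := i) Flin) ?addr0 // ffunE eqxx.
Qed.

Lemma symmap_adj n (f : symmap V n) (p : {ffun 'I_n -> bool})
    (v : {ffun 'I_n -> V}) (a b : 'I_n) :
  (forall i, v i \in homog (p i)) -> b = a.+1 :> nat ->
  f [ffun i => v (tperm a b i)] = (-1) ^+ (p a && p b) *: f v.
Proof.
move=> hv ab; rewrite (symmap_supersym f hv (tperm a b)) scalerA.
have := koszul_adj k p 1%g ab; rewrite mulg1 !perm1 koszul1 mulr1 => ->.
by rewrite -expr2 sqrr_sign scale1r.
Qed.

Lemma symmap_adj_off n (f : symmap V n) (p : {ffun 'I_n -> bool})
    (v : {ffun 'I_n -> V}) (c a b : 'I_n) :
  (forall i, i != c -> v i \in homog (p i)) -> b = a.+1 :> nat ->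
  a != c -> b != c ->
  f [ffun i => v (tperm a b i)] = (-1) ^+ (p a && p b) *: f v.
Proof.
move=> hv ab ac bc.
have vE : v = upd v c (1 *: superpart false (v c) + superpart true (v c)).
  apply/ffunP => i; rewrite ffunE scale1r -superpart_split.
  by case: eqP => // ->.
rewrite {1 2}vE upd_perm !symmap_multilinear !scale1r scalerDr.
have tc : (tperm a b)^-1%g c = c by rewrite tpermV tpermD.
have key s : f (upd [ffun i => v (tperm a b i)] c (superpart s (v c))) =
    (-1) ^+ (p a && p b) *: f (upd v c (superpart s (v c))).
  pose q := [ffun i => if i == c then s else p i].
  have hq i : upd v c (superpart s (v c)) i \in homog (q i).
    by rewrite !ffunE; case: eqP => [_|/eqP/hv //]; apply: superpart_homog.
  have := symmap_adj f hq ab; rewrite upd_perm tc => ->.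
  by rewrite !ffunE (negbTE ac) (negbTE bc).
by rewrite tc !key.
Qed.

End AdjacentSwaps.

Section NijenhuisRichardson.
Variables (k : fieldType) (V : superModType k).

Section Wedge.
Variables (n m : nat) (f : superD V n) (g : superD V m).

(* f(g(v_0,...,v_m), v_(m+1),...,v_(m+n)) *)
Definition barwedge_term (v : {ffun 'I_(n + m).+1 -> V}) : V :=
  f [ffun i : 'I_n.+1 =>
       if i == ord0 then g [ffun j : 'I_m.+1 => v (inord j)]
       else v (inord (m + i))].

Lemma barwedge_term_multilinear : multilinear barwedge_term.
Proof.
move=> v a c x y; rewrite /barwedge_term.
pose inner v : {ffun 'I_m.+1 -> V} :=
  [ffun j : 'I_m.+1 => (v : {ffun 'I_(n + m).+1 -> V}) (inord j)].
pose outer v : {ffun 'I_n.+1 -> V} := [ffun i : 'I_n.+1 =>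
  if i == ord0 then g (inner v) else v (inord (m + i))].
rewrite -/(inner _) -/(inner (upd v a x)) -/(inner (upd v a y)).
rewrite -/(outer _) -/(outer (upd v a x)) -/(outer (upd v a y)).
have [am|am] := ltnP a m.+1.
  have innerE z : inner (upd v a z) = upd (inner v) (inord a) z.
    apply/ffunP => j; rewrite !ffunE; congr (if _ then _ else _).
    have hj := ltn_ord j.
    by rewrite -!val_eqE /= !inordK //; lia.
  have outerE z : outer (upd v a z) =
      upd (outer v) ord0 (g (upd (inner v) (inord a) z)).
    apply/ffunP => i; rewrite !ffunE innerE; case: eqP => // /eqP ni.
    have hi := ltn_ord i; rewrite ifN // -val_eqE /= inordK;
      move: ni; rewrite -val_eqE /=; lia.
  by rewrite !outerE symmap_multilinear symmap_multilinear.
have innerE z : inner (upd v a z) = inner v.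
  apply/ffunP => j; rewrite !ffunE ifN //; have hj := ltn_ord j.
  by rewrite -val_eqE /= inordK; lia.
have ha := ltn_ord a.
have outerE z : outer (upd v a z) = upd (outer v) (inord (a - m)) z.
  apply/ffunP => i; rewrite !ffunE innerE; have hi := ltn_ord i.
  have [->|ni] := eqVneq i ord0.
    by rewrite ifN // -val_eqE /= inordK; lia.
  congr (if _ then _ else _); move: ni.
  by rewrite -!val_eqE /= !inordK; lia.
by rewrite !outerE symmap_multilinear.
Qed.

Lemma barwedge_term_sym : block_supersym m.+1 barwedge_term.
Proof.
move=> p v hv a b ab hj; rewrite /barwedge_term.
have ha := ltn_ord a; have hb := ltn_ord b.
pose w : {ffun 'I_m.+1 -> V} := [ffun j : 'I_m.+1 => v (inord j)].
pose u : {ffun 'I_n.+1 -> V} := [ffun i : 'I_n.+1 =>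
  if i == ord0 then g w else v (inord (m + i))].
pose h1 (j : 'I_m.+1) : 'I_(n + m).+1 := inord j.
pose h2 (i : 'I_n.+1) : 'I_(n + m).+1 := inord (m + i).
have h1E j : h1 j = j :> nat by rewrite inordK //; have := ltn_ord j; lia.
have h2E i : h2 i = (m + i)%N :> nat.
  by rewrite inordK //; have := ltn_ord i; lia.
have h1_inj : injective h1.
  by move=> j j' /(congr1 val) /=; rewrite !h1E => /val_inj.
have h2_inj : injective h2.
  move=> j j' /(congr1 val) /=; rewrite !h2E => e; apply: val_inj => /=; lia.
rewrite -/w -/u; case/orP: hj => hj.
  pose a' : 'I_m.+1 := inord a; pose b' : 'I_m.+1 := inord b.
  have a'E : a' = a :> nat by rewrite inordK //; lia.
  have b'E : b' = b :> nat by rewrite inordK //; lia.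
  have ea : h1 a' = a by apply: val_inj; rewrite /= h1E.
  have eb : h1 b' = b by apply: val_inj; rewrite /= h1E.
  have -> : [ffun j : 'I_m.+1 => [ffun i => v (tperm a b i)] (inord j)] =
     [ffun j => w (tperm a' b' j)].
    apply/ffunP => j; rewrite !ffunE -[inord j]/(h1 j) -{1}ea -{1}eb.
    by rewrite -inj_tperm.
  have hw j : w j \in homog ([ffun j => p (h1 j)] j) by rewrite !ffunE.
  have a'b' : b' = a'.+1 :> nat by rewrite a'E b'E.
  rewrite (symmap_adj g hw a'b') !ffunE ea eb.
  set c := (-1) ^+ _.
  have -> : [ffun i : 'I_n.+1 => if i == ord0 then c *: g w
       else [ffun i0 => v (tperm a b i0)] (inord (m + i))] =
       upd u ord0 (c *: g w).
    apply/ffunP => i; rewrite !ffunE; case: eqP => // /eqP ni.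
    rewrite -[inord _]/(h2 i) tpermD // -val_eqE /= h2E;
      move: ni; rewrite -val_eqE /=; lia.
  rewrite (multilinearZ _ _ _ _ (symmap_multilinear f)).
  by congr (_ *: f _); apply/ffunP => i; rewrite !ffunE; case: eqP.
pose a' : 'I_n.+1 := inord (a - m); pose b' : 'I_n.+1 := inord (b - m).
have a'E : a' = (a - m)%N :> nat by rewrite inordK //; lia.
have b'E : b' = (b - m)%N :> nat by rewrite inordK //; lia.
have ea : h2 a' = a by apply: val_inj; rewrite /= h2E; lia.
have eb : h2 b' = b by apply: val_inj; rewrite /= h2E; lia.
have na : a' != ord0 by rewrite -val_eqE /=; lia.
have nb : b' != ord0 by rewrite -val_eqE /=; lia.
have a'b' : b' = a'.+1 :> nat by rewrite a'E b'E; lia.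
have hu i : i != ord0 -> u i \in homog ([ffun i => p (h2 i)] i).
  by move=> ni; rewrite !ffunE (negbTE ni).
have := symmap_adj_off f hu a'b' na nb; rewrite !ffunE ea eb => <-.
congr (f _); apply/ffunP => i; rewrite !ffunE.
have -> : [ffun j : 'I_m.+1 => [ffun i => v (tperm a b i)] (inord j)] = w.
  apply/ffunP => j; rewrite !ffunE -[inord j]/(h1 j) tpermD //;
    rewrite -val_eqE /= h1E; have := ltn_ord j; lia.
have -> : (tperm a' b' i == ord0) = (i == ord0).
  by case: tpermP => [->|->|//]; rewrite (negbTE na) (negbTE nb).
by case: eqP => // _; rewrite -[inord (m + i)]/(h2 i) -{1}ea -{1}eb -inj_tperm.
Qed.

Definition barwedge : superD V (n + m) :=
  shuffle_symmap barwedge_term_multilinear barwedge_term_sym.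

End Wedge.

(* For [f] of parity [s] and [g] of parity [t] only the summand (s, t) is
   nonzero, and it is f /\ g - (-1)^(st) g /\ f; for general [f] and [g] this
   is the bilinear extension.                                                *)
Definition NRbracket n m (f : superD V n) (g : superD V m) :
    superD V (n + m) :=
  \sum_(s : bool) \sum_(t : bool)
    (barwedge (sympart s f) (sympart t g) - (-1) ^+ (s && t) *:
       ecast N (superD V N) (addnC m n) (barwedge (sympart t g) (sympart s f))).

(* D(V), the product of all D_n(V). *)
Definition superDprod := forall n, superD V n.
Implicit Types w : superDprod.

HB.instance Definition _ := gen_eqMixin superDprod.
HB.instance Definition _ := gen_choiceMixin superDprod.

Definition Dprod0 : superDprod := fun n => 0.
Definition DprodD w1 w2 : superDprod := fun n => w1 n + w2 n.
Definition DprodN w : superDprod := fun n => - w n.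
Definition DprodZ (c : k) w : superDprod := fun n => c *: w n.

Lemma DprodDA : associative DprodD.
Proof.
by move=> x y z; apply: functional_extensionality_dep => n; apply: addrA.
Qed.
Lemma DprodDC : commutative DprodD.
Proof.
by move=> x y; apply: functional_extensionality_dep => n; apply: addrC.
Qed.
Lemma Dprod0D : left_id Dprod0 DprodD.
Proof.
by move=> x; apply: functional_extensionality_dep => n; apply: add0r.
Qed.
Lemma DprodND : left_inverse Dprod0 DprodN DprodD.
Proof.
by move=> x; apply: functional_extensionality_dep => n; apply: addNr.
Qed.

HB.instance Definition _ := GRing.isZmodule.Build superDprod
  DprodDA DprodDC Dprod0D DprodND.

Lemma DprodZA a b w : DprodZ a (DprodZ b w) = DprodZ (a * b) w.
Proof. by apply: functional_extensionality_dep => n; apply: scalerA. Qed.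
Lemma Dprod1Z : left_id 1 DprodZ.
Proof.
by move=> x; apply: functional_extensionality_dep => n; apply: scale1r.
Qed.
Lemma DprodZDr : right_distributive DprodZ +%R.
Proof.
by move=> a x y; apply: functional_extensionality_dep => n; apply: scalerDr.
Qed.
Lemma DprodZDl w : {morph DprodZ^~ w : a b / a + b}.
Proof.
by move=> a b; apply: functional_extensionality_dep => n; apply: scalerDl.
Qed.

HB.instance Definition _ := GRing.Zmodule_isLmodule.Build k superDprod
  DprodZA Dprod1Z DprodZDr DprodZDl.

(* The inclusion of the factor D_n(V) in D(V). *)
Definition inD n (f : superD V n) : superDprod := fun N =>
  if n =P N is ReflectT e then ecast i (superD V i) e f else 0.

(* [f, g]_N is the sum of the [f_i, g_j] with i + j = N. *)
Definition bracket (f g : superDprod) : superDprod := fun N =>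
  \sum_(i < N.+1) ecast j (superD V j) (subnKC (leq_ord i))
    (NRbracket (f i) (g (N - i)%N)).

End NijenhuisRichardson.

Section Words.
Variables (k : fieldType) (A : superAlgType k).

HB.instance Definition _ (a : A) :=
  GRing.isLinear.Build k A A _ (smul a) (smul_linear_r a).

Lemma smul_is_linear_l (b : A) c x y :
  smul (c *: x + y) b = c *: smul x b + smul y b.
Proof. exact: smul_linear_l. Qed.

Definition word n (v : {ffun 'I_n -> A}) : seq A := [seq v i | i <- enum 'I_n].

(* ((a w_1) w_2) ... *)
Definition smulw (a : A) (w : seq A) : A := foldl smul a w.

(* w_1 w_2 ... ; only meaningful for nonempty [w], as A has no unit. *)
Definition sprod (w : seq A) : A := if w is a :: w' then smulw a w' else 0.

Lemma smulw_linear w c x y :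
  smulw (c *: x + y) w = c *: smulw x w + smulw y w.
Proof. by elim: w x y => //= a w IH x y; rewrite smul_is_linear_l IH. Qed.

Lemma smulw0 w : smulw 0 w = 0.
Proof.
by have := smulw_linear w (-1) 0 0; rewrite scaler0 addr0 scaleN1r addNr.
Qed.

Lemma smulwZ w c x : smulw (c *: x) w = c *: smulw x w.
Proof. by rewrite -[c *: x]addr0 smulw_linear smulw0 addr0. Qed.

Lemma smulw_linear_mid a w1 w2 c x y :
  smulw a (w1 ++ (c *: x + y) :: w2) =
  c *: smulw a (w1 ++ x :: w2) + smulw a (w1 ++ y :: w2).
Proof. by rewrite /smulw !foldl_cat /= linearP -/(smulw _ _) smulw_linear. Qed.

Lemma sprod_linear_mid w1 w2 c x y :
  sprod (w1 ++ (c *: x + y) :: w2) =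
  c *: sprod (w1 ++ x :: w2) + sprod (w1 ++ y :: w2).
Proof. by case: w1 => [|a w1] /=; rewrite ?smulw_linear ?smulw_linear_mid. Qed.

Lemma size_word n (v : {ffun 'I_n -> A}) : size (word v) = n.
Proof. by rewrite size_map size_enum_ord. Qed.

Lemma nth_word n (v : {ffun 'I_n -> A}) (i : 'I_n) : nth 0 (word v) i = v i.
Proof. by rewrite (nth_map i) ?size_enum_ord // nth_ord_enum. Qed.

Lemma word_eq n (v : {ffun 'I_n -> A}) (w : seq A) :
  size w = n -> (forall i : 'I_n, nth 0 w i = v i) -> word v = w.
Proof.
move=> sw h; apply: (@eq_from_nth _ 0); rewrite size_word // => i hi.
by rewrite (nth_word v (Ordinal hi)) -h.
Qed.

Lemma word_upd n (v : {ffun 'I_n -> A}) (i : 'I_n) : exists w1 w2,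
  size w1 = i /\ forall x, word (upd v i x) = w1 ++ x :: w2.
Proof.
have hi := ltn_ord i.
have s1 : size (take i (word v)) = i by rewrite size_takel // size_word ltnW.
exists (take i (word v)), (drop i.+1 (word v)); split=> // x.
apply: word_eq => [|j].
  by rewrite size_cat /= s1 size_drop size_word; lia.
rewrite nth_cat s1 ffunE -val_eqE /=; have hj := ltn_ord j.
case: ltngtP => [ji|ij|->]; last by rewrite subnn.
  by rewrite nth_take // nth_word.
have -> : (j - i = (j - i.+1).+1)%N by lia.
by rewrite /= nth_drop subnKC // nth_word.
Qed.

Lemma word_adj n (v : {ffun 'I_n -> A}) (a b : 'I_n) : b = a.+1 :> nat ->
  exists w1 w2, [/\ size w1 = a, word v = w1 ++ v a :: v b :: w2 &
    word [ffun i => v (tperm a b i)] = w1 ++ v b :: v a :: w2].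
Proof.
move=> ab; have hb := ltn_ord b.
have s1 : size (take a (word v)) = a by rewrite size_takel // size_word; lia.
have size12 x y : size (take a (word v) ++ x :: y :: drop a.+2 (word v)) = n.
  by rewrite size_cat /= s1 size_drop size_word; lia.
exists (take a (word v)), (drop a.+2 (word v)); split=> //;
  apply: word_eq => // j; rewrite nth_cat s1 ?ffunE; have hj := ltn_ord j.
  have [ja|aj] := ltnP j a; first by rewrite nth_take // nth_word.
  have [e|na] := eqVneq j a; first by rewrite e subnn.
  have [e|nb] := eqVneq j b; first by rewrite e ab subSnn.
  move: na nb; rewrite -!val_eqE /= => na nb.
  have -> : (j - a = (j - a.+2).+2)%N by lia.
  by rewrite /= nth_drop subnKC ?nth_word //; lia.
have [ja|aj] := ltnP j a.
  by rewrite nth_take // nth_word tpermD // -val_eqE /=; lia.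
have [e|na] := eqVneq j a; first by rewrite e subnn tpermL.
have [e|nb] := eqVneq j b; first by rewrite e ab subSnn tpermR.
rewrite tpermD 1?eq_sym //; move: na nb; rewrite -!val_eqE /= => na nb.
have -> : (j - a = (j - a.+2).+2)%N by lia.
by rewrite /= nth_drop subnKC ?nth_word //; lia.
Qed.

End Words.

Section Antibrackets.
Variables (k : fieldType) (A : comSuperAlgType k).

Lemma smulw_swap (s t : bool) (a x y : A) w1 w2 :
  x \in homog s -> y \in homog t ->
  smulw a (w1 ++ y :: x :: w2) =
  (-1) ^+ (s && t) *: smulw a (w1 ++ x :: y :: w2).
Proof.
move=> hx hy; rewrite /smulw !foldl_cat /= -!smulA.
by rewrite (smulC _ _ _ _ hy hx) andbC linearZ -/(smulw _ _) smulwZ.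
Qed.

Lemma sprod_swap (s t : bool) (x y : A) w1 w2 :
  x \in homog s -> y \in homog t ->
  sprod (w1 ++ y :: x :: w2) =
  (-1) ^+ (s && t) *: sprod (w1 ++ x :: y :: w2).
Proof.
move=> hx hy; case: w1 => [|a w1] /=; last exact: smulw_swap.
by rewrite /smulw /= (smulC _ _ _ _ hy hx) andbC -/(smulw _ _) smulwZ.
Qed.

Definition mu_fun n (v : {ffun 'I_n.+1 -> A}) : A := sprod (word v).

Lemma mu_multilinear n : multilinear (@mu_fun n).
Proof.
move=> v i c x y; have [w1 [w2 [_ h]]] := word_upd v i.
by rewrite /mu_fun !h sprod_linear_mid.
Qed.

Lemma mu_sym n : supersymmetric (@mu_fun n).
Proof.
apply: block_supersym_full => p v hv a b ab _.
have [w1 [w2 [_ h1 h2]]] := word_adj v ab.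
by rewrite /mu_fun h1 h2 (sprod_swap _ _ (hv a) (hv b)).
Qed.

Definition mu n : superD A n := Symmap (@mu_multilinear n) (@mu_sym n).

Definition rho n (w : superDprod A) : superDprod A := bracket (inD (mu n)) w.

Section Phi.
Variable f : {linear A -> A}.

(* f(v_1 ... v_j) v_(j+1) ... v_n *)
Definition Phi_term n (j : nat) (v : {ffun 'I_n -> A}) : A :=
  smulw (f (sprod (take j (word v)))) (drop j (word v)).

Lemma Phi_term_multilinear n j : multilinear (@Phi_term n j).
Proof.
move=> v i c x y; have [w1 [w2 [s1 h]]] := word_upd v i.
rewrite /Phi_term !h !take_cat !drop_cat s1; case: ltnP => ij.
  by rewrite smulw_linear_mid.
case: (j - i)%N => [|d] /=.
  by rewrite cats0; apply: (smulw_linear_mid _ [::]).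
by rewrite sprod_linear_mid linearP smulw_linear.
Qed.

Lemma Phi_term_sym n j : block_supersym j (@Phi_term n j).
Proof.
move=> p v hv a b ab hj; have [w1 [w2 [s1 h1 h2]]] := word_adj v ab.
rewrite /Phi_term h1 h2 !take_cat !drop_cat s1; case: ltnP => ij.
  by rewrite (smulw_swap _ _ _ (hv a) (hv b)).
case e: (j - a)%N => [|d] /=.
  by rewrite cats0; apply: (smulw_swap _ [::] _ (hv a) (hv b)).
case: d e => [|d] e /=; first by move: hj; rewrite ab; lia.
by rewrite (sprod_swap _ _ (hv a) (hv b)) linearZ smulwZ.
Qed.

(* The higher antibracket of [f] in [n] variables. *)
Definition Phi n : symmap A n := \sum_(1 <= j < n.+1)
  (-1) ^+ (n - j) *:
    shuffle_symmap (@Phi_term_multilinear n j) (@Phi_term_sym n j).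

End Phi.
End Antibrackets.

(* Main.v *)
(* Write N = n + 1. On homogeneous arguments, let S_j be the sum over all of
   S_N, with Koszul signs, of f(a_1 ... a_j) a_(j+1) ... a_N. In
   characteristic 0 a sum over S(j, N - j) is the full sum divided by
   j! (N - j)!, so Phi^N is the combination of the
   T_j = S_j / (j! (N - j)!) with coefficients (-1)^(N-j). Composing two
   symmetrized maps and symmetrizing again gives, with m + h = N,
     mu_h /\ Phi^m = sum_j (-1)^(m-j) C(N-j, h) T_j,
     Phi^m /\ mu_h = sum_j (-1)^(m-j) (C(j+h, h+1) T_(j+h) + C(N-j, h+1) T_j);
   the two terms of the second line correspond to the product of h + 1 factors
   being inside or outside the argument of f. Hence the coefficient of T_j in
   sum_h (-1)^h [mu_h, Phi^m] is (-1)^(N-j) times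
     sum_(h=1)^n (C(N-j, h) - C(N-j, h+1) - (-1)^h C(j, h+1)) = n. *)
Require Import Defs.
From HB Require Import structures.
From mathcomp Require Import all_boot all_order all_algebra all_fingroup.
From mathcomp Require Import boolp zify ring.
Set Implicit Arguments.
Unset Strict Implicit.
Unset Printing Implicit Defensive.
Import GRing.Theory.
Local Open Scope ring_scope.

(** * Young subgroups: full sums over the symmetric group against sums over shuffles *)

Section BlockPermutations.
Variable n : nat.
Implicit Types s t y : 'S_n.

(** Adjacent swaps inside the two blocks carry [s] and [y * s] to shuffles without changing [G].
    These shuffles differ by a block permutation, hence coincide by [shuffle_unique]. *)
Lemma adj_inv_blockperm (T : eqType) j (G : 'S_n -> T) y s :
  adj_inv j G -> blockperm j y -> G (y * s)%g = G s.
Proof.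
move=> Ginv yb.
have [y0 [b0 s0 <-]] := shuffle_exists s Ginv.
have [y1 [b1 s1 <-]] := shuffle_exists (y * s)%g Ginv.
have b : blockperm j (y1 * y * y0^-1)%g.
  by apply: blockpermM (blockpermM b1 yb) (blockpermV b0).
have E : (y1 * y * y0^-1 * (y0 * s) = y1 * (y * s))%g by rewrite !mulgA mulgKV.
have := shuffle_unique b s0; rewrite E => /(_ s1) e.
by rewrite -E e mul1g.
Qed.

(** The Young subgroup is the product of the symmetric groups of [S] and of its complement, which
    meet trivially. *)
Lemma card_blockperm j : (j <= n)%N ->
  #|[set y : 'S_n | blockperm j y]| = (j`! * (n - j)`!)%N.
Proof.
move=> jn; pose S := [set i : 'I_n | (i < j)%N].
have cS : #|S| = j.
  have w_inj : injective (widen_ord jn) by move=> x y [] /val_inj.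
  rewrite -[RHS]card_ord -cardsT -(card_imset _ w_inj); apply: eq_card => i.
  rewrite inE; apply/idP/imsetP => [ij|[x _ ->]]; last exact: ltn_ord x.
  by exists (Ordinal ij) => //; apply: val_inj.
have cSC : #|~: S| = (n - j)%N by rewrite cardsCs setCK cS card_ord.
rewrite -{2}cS -cSC -!card_Sym -TI_cardMg.
  apply: eq_card => y; rewrite inE; apply/idP/mulsgP.
    move=> yb.
    have yN : y \in ('N(S | 'P))%g.
      apply/astabsP => i /=; rewrite /aperm !inE.
      by move/forallP: yb => /(_ i)/eqP.
    have yNC : y \in ('N(~: S | 'P))%g by rewrite astabsC.
    exists (restr_perm S y) (restr_perm (~: S) y);
      rewrite ?inE ?restr_perm_on //.
    apply/permP => i; rewrite permM.
    have [iS|iS] := boolP (i \in S).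
      rewrite (restr_permE yN iS) (out_perm (restr_perm_on _ _)) //.
      by rewrite inE negbK -/(aperm i y) (astabsP yN).
    rewrite (out_perm (restr_perm_on S y) iS) restr_permE //.
    by rewrite inE.
  case=> s t; rewrite !inE => hs ht ->; apply/forallP => i.
  have hsi : (s i < j)%N = (i < j)%N by have := perm_closed i hs; rewrite !inE.
  have := perm_closed (s i) ht; rewrite permM !inE => /negb_inj ->.
  by rewrite hsi.
apply/trivgP/subsetP => y; rewrite !inE => /andP[hy hyC].
apply/eqP/permP => i; rewrite perm1.
have [iS|iS] := boolP (i \in S); last exact: out_perm hy iS.
by apply: out_perm hyC _; rewrite inE iS.
Qed.

(** Each coset of the Young subgroup contains exactly one shuffle, and [G] is constant on it. *)
Lemma sum_shuffles_all (V : zmodType) j (G : 'S_n -> V) : (j <= n)%N ->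
  adj_inv j G ->
  \sum_s G s = (\sum_(s in shuffles n j) G s) *+ (j`! * (n - j)`!).
Proof.
move=> jn Ginv; rewrite -card_blockperm //.
(* With a constant function [shuffle_exists] gives just the shuffle in the coset. *)
have tri : adj_inv j (fun _ : 'S_n => tt) by [].
have ex s : exists y, blockperm j y && ((y * s)%g \in shuffles n j).
  by have [y [yb ys _]] := shuffle_exists s tri; exists y; rewrite yb.
pose r s := xchoose (ex s).
have rP s : blockperm j (r s) /\ (r s * s)%g \in shuffles n j.
  by apply/andP; apply: (xchooseP (ex s)).
rewrite (partition_big (fun s => r s * s)%g (mem (shuffles n j))) /=;
  last by move=> s _; have [] := rP s.
rewrite -sumrMnl; apply: eq_bigr => t ht.
rewrite (reindex_inj (mulIg t)) -sumr_const.
symmetry; apply: eq_big => [y|y]; rewrite ?inE; last first.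
  by move=> yb; rewrite (adj_inv_blockperm _ Ginv yb).
have [rb rs] := rP (y * t)%g; rewrite mulgA in rs *.
apply/idP/eqP => [yb|].
  by rewrite (shuffle_unique (blockpermM rb yb) ht rs) mul1g.
move/(canRL (mulgK _)); rewrite mulgV => /(canRL (mulKg _)) ->.
by rewrite mulg1; apply: blockpermV.
Qed.

(** Composition with the transposition of [i] and [c] turns these permutations into those that fix
    [c]. *)
Lemma card_perm_maps (i c : 'I_n) :
  #|[set s : 'S_n | s i == c]| = (n.-1)`!.
Proof.
have := card_perm [set~ c]; rewrite cardsC1 card_ord => <-.
have inj : injective (fun s : 'S_n => tperm i c * s)%g by apply: mulgI.
rewrite -(card_imset _ inj); apply: eq_card => s.
apply/imsetP/idP => [[t]|hs].
  rewrite inE => /eqP tc ->.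
  apply/subsetP => x; rewrite !inE; apply: contra => /eqP ->.
  by rewrite permM tpermR tc.
exists (tperm i c * s)%g; last by rewrite mulgA tperm2 mul1g.
rewrite inE permM tpermL (out_perm hs) //.
by rewrite !inE eqxx.
Qed.

End BlockPermutations.

Lemma odd_card_addb (T : finType) (P p : pred T) :
  odd #|[set x | P x && p x]| = \big[addb/false]_(x | P x) p x.
Proof.
rewrite cardsE -sum1_card big_mkcondr /=.
by elim/big_rec2: _ => // i b n _ <-; rewrite oddD; case: (p i).
Qed.

(** * The Koszul sign of a cyclic rotation *)

Section Rotation.
Variables (k : fieldType) (M c : nat).
Hypothesis cM : (c <= M.+1)%N.

Definition rot_ord (i : 'I_M.+1) : 'I_M.+1 :=
  inord (if (i + c < M.+1)%N then i + c else i + c - M.+1)%N.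

Lemma rot_ordE i :
  rot_ord i = (if (i + c < M.+1)%N then i + c else i + c - M.+1)%N :> nat.
Proof. by rewrite inordK //; have := ltn_ord i; case: ifP; lia. Qed.

Lemma rot_ord_inj : injective rot_ord.
Proof.
move=> i j /(congr1 val) /=; rewrite !rot_ordE => e; apply: ord_inj.
by have := ltn_ord i; have := ltn_ord j; move: e; do 2 case: ifP; lia.
Qed.

Definition rot_perm : 'S_M.+1 := perm rot_ord_inj.

(** The inverted pairs are exactly those formed by one of the first [c] letters and one of the
    others. So the odd ones number [#|X| * #|Y|], whose parity is the conjunction of the two
    parities. *)
Lemma koszul_rot (p : {ffun 'I_M.+1 -> bool}) :
  koszul k p rot_perm = (-1) ^+ ((\big[addb/false]_(0 <= i < c) p (inord i)) &&
                            \big[addb/false]_(c <= i < M.+1) p (inord i)).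
Proof.
pose X := [set i : 'I_M.+1 | (i < c)%N && p i].
pose Y := [set i : 'I_M.+1 | (c <= i)%N && p i].
have -> : \big[addb/false]_(0 <= i < c) p (inord i) = odd #|X|.
  rewrite odd_card_addb (big_nat_widen _ _ _ _ _ cM) big_mkord.
  by apply: eq_bigr => i _; rewrite inord_val.
have -> : \big[addb/false]_(c <= i < M.+1) p (inord i) = odd #|Y|.
  rewrite odd_card_addb big_geq_mkord.
  by apply: eq_bigr => i _; rewrite inord_val.
rewrite -oddM signr_odd mulnC -cardsX /koszul; congr (_ ^+ _).
(* [g] replaces a pair of places by the pair of letters found there, so that the inversions become
   the product of [Y] and [X]. *)
pose g (xy : 'I_M.+1 * 'I_M.+1) := (rot_perm xy.1, rot_perm xy.2).
have g_inj : injective g by move=> [x y] [x' y'] [/perm_inj-> /perm_inj->].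
rewrite -[LHS](card_imset _ g_inj); apply: eq_card => -[x y].
have -> : (x, y) = g ((rot_perm^-1)%g x, (rot_perm^-1)%g y).
  by rewrite /g /= !permKV.
move: ((rot_perm^-1)%g x) ((rot_perm^-1)%g y) => {x y} x y.
rewrite (mem_imset _ _ g_inj) !inE /= !permE !rot_ordE.
have := ltn_ord x; have := ltn_ord y; do 2 case: ifP => ?;
  case: (p _); case: (p _); rewrite ?andbF ?andbT //; lia.
Qed.

End Rotation.

(** * Signed sums over the full symmetric group at fixed homogeneous arguments *)

Section Symmetrization.
Variables (k : fieldType) (V : superModType k).

Lemma koszul_tperm N (p : {ffun 'I_N -> bool}) (a b : 'I_N) :
  b = a.+1 :> nat -> koszul k p (tperm a b) = (-1) ^+ (p a && p b).
Proof.
by move=> ab; have := koszul_adj k p 1 ab; rewrite mulg1 koszul1 !perm1 mulr1.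
Qed.

Section Fixed.
Variables (N : nat) (p : {ffun 'I_N -> bool}) (v : {ffun 'I_N -> V}).
Hypothesis hv : forall i, v i \in homog (p i).
Implicit Types U : {ffun 'I_N -> bool} -> {ffun 'I_N -> V} -> V.

(** [U] also receives the parities, because the formulas symmetrized below carry Koszul signs of
    their own. *)
Definition symmetrize U : V :=
  \sum_(s : 'S_N) koszul k p s *: U [ffun i => p (s i)] [ffun i => v (s i)].

Lemma eq_symmetrize U U' :
  (forall (q : {ffun 'I_N -> bool}) (u : {ffun 'I_N -> V}),
     (forall i, u i \in homog (q i)) -> U q u = U' q u) ->
  symmetrize U = symmetrize U'.
Proof.
by move=> e; apply: eq_bigr => s _; rewrite e // => i; rewrite !ffunE.
Qed.

Lemma symmetrizeZ c U : symmetrize (fun q u => c *: U q u) = c *: symmetrize U.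
Proof.
by rewrite scaler_sumr; apply: eq_bigr => s _; rewrite !scalerA mulrC.
Qed.

Lemma symmetrize_sum I r (P : pred I)
    (U : I -> {ffun 'I_N -> bool} -> {ffun 'I_N -> V} -> V) :
  symmetrize (fun q u => \sum_(i <- r | P i) U i q u) =
  \sum_(i <- r | P i) symmetrize (U i).
Proof. by rewrite exchange_big; apply: eq_bigr => s _; rewrite scaler_sumr. Qed.

(** Left translation of the summation index by [t] changes the sign according to the cocycle rule
    [koszulM]. *)
Lemma symmetrize_perm t U U' :
  (forall (q : {ffun 'I_N -> bool}) (u : {ffun 'I_N -> V}),
     (forall i, u i \in homog (q i)) ->
     U' q u = koszul k q t *: U [ffun i => q (t i)] [ffun i => u (t i)]) ->
  symmetrize U' = symmetrize U.
Proof.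
move=> e; rewrite [RHS](reindex_inj (mulgI t)) /=; apply: eq_bigr => s _.
rewrite e => [|i]; last by rewrite !ffunE.
rewrite koszulM scalerA; congr (_ *: U _ _);
  by apply/ffunP => i; rewrite !ffunE permM.
Qed.

Lemma shuffle_symmetrize j (T : {ffun 'I_N -> V} -> V) (Tlin : multilinear T)
    (Tsym : block_supersym j T) : [pchar k] =i pred0 -> (j <= N)%N ->
  shuffle_symmap Tlin Tsym v =
  (j`! * (N - j)`!)%:R^-1 *: symmetrize (fun=> T).
Proof.
move=> char0 jN.
have Flin q : multilinear (fun v : {ffun 'I_N -> V} =>
    \sum_(s in shuffles N j) koszul k q s *: T [ffun i => v (s i)]).
  apply: multilinear_sum => s; apply: multilinear_scale.
  exact: multilinear_perm.
rewrite /= /shuffle_sum (homog_extendE Flin hv).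
rewrite /symmetrize (sum_shuffles_all jN (block_adj_inv Tsym hv)).
rewrite -scaler_nat scalerA mulVf ?scale1r //.
by rewrite ((pcharf0P _).1 char0) -lt0n muln_gt0 !fact_gt0.
Qed.

(* Permuting adjacent letters of the word [w u] amounts to permuting adjacent
   letters of [u], which symmetrization absorbs. *)
Lemma symmetrize_inner m l
    (wq : {ffun 'I_N -> bool} -> {ffun 'I_m -> bool})
    (w : {ffun 'I_N -> V} -> {ffun 'I_m -> V})
    (K : {ffun 'I_N -> V} -> {ffun 'I_m -> V} -> V) :
  (forall a b : 'I_m, b = a.+1 :> nat -> (b < l)%N || (l <= a)%N ->
     exists a' b' : 'I_N, [/\ b' = a'.+1 :> nat,
       forall q : {ffun 'I_N -> bool}, wq [ffun i => q (tperm a' b' i)] =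
                 [ffun i => wq q (tperm a b i)],
       forall q : {ffun 'I_N -> bool}, (wq q a && wq q b) = (q a' && q b'),
       forall u : {ffun 'I_N -> V}, w [ffun i => u (tperm a' b' i)] =
                 [ffun i => w u (tperm a b i)] &
       forall (u : {ffun 'I_N -> V}) x,
         K [ffun i => u (tperm a' b' i)] x = K u x]) ->
  forall t y : 'S_m, blockperm l y ->
  let H t := symmetrize
    (fun q u => koszul k (wq q) t *: K u [ffun i => w u (t i)]) in
  H (t * y)%g = H t.
Proof.
move=> adj t y yb H.
(* Inversion turns the right factor [y] into the left factor required by [adj_inv]. *)
have Hinv : adj_inv l (fun s => H s^-1%g).
  move=> s a b ab hj; have [a' [b' [ab' wqE wqab wE KE]]] := adj a b ab hj.
  rewrite invMg tpermV; apply: (symmetrize_perm (t := tperm a' b')) => q u _.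
  rewrite wqE wE KE koszulM scalerA !koszul_tperm // wqab; congr (_ *: K _ _).
  by apply/ffunP => i; rewrite !ffunE permM.
have := adj_inv_blockperm t^-1%g Hinv (blockpermV yb).
by rewrite invMg !invgK.
Qed.

End Fixed.
End Symmetrization.

Lemma natr_neq0_pchar0 (R : idomainType) n :
  [pchar R] =i pred0 -> (0 < n)%N -> n%:R != 0 :> R.
Proof. by move=> char0; rewrite ((pcharf0P R).1 char0) -lt0n. Qed.

(** * Words of letters and their products *)

Section Words.
Variables (k : fieldType) (A : superAlgType k).

Lemma word_first M m (u : {ffun 'I_M.+1 -> A}) : (m <= M)%N ->
  word [ffun j : 'I_m.+1 => u (inord j)] = take m.+1 (word u).
Proof.
move=> mM; apply: word_eq => [|i]; first by rewrite size_takel // size_word.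
have hi := ltn_ord i.
by rewrite nth_take // ffunE -nth_word inordK //; lia.
Qed.

Lemma word_plug n m x (u : {ffun 'I_(n + m).+1 -> A}) :
  word [ffun i : 'I_n.+1 => if i == ord0 then x else u (inord (m + i))] =
  x :: drop m.+1 (word u).
Proof.
apply: word_eq => [|i]; first by rewrite /= size_drop size_word; lia.
rewrite ffunE; case: eqVneq => [->|] //; rewrite -val_eqE /= => ni.
have hi := ltn_ord i.
case: (i : nat) ni hi => // i' _ hi /=.
by rewrite nth_drop addSnnS -nth_word inordK //; lia.
Qed.

Lemma word_rot M c (cM : (c <= M.+1)%N) (u : {ffun 'I_M.+1 -> A}) :
  word [ffun i => u (rot_perm cM i)] = rot c (word u).
Proof.
apply: word_eq => [|i]; first by rewrite size_rot size_word.
rewrite ffunE permE -nth_word rot_ordE // nth_cat size_drop size_word.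
have hi := ltn_ord i; case: ifP => h; case: ifP => h'; try lia.
  by rewrite nth_drop addnC.
by rewrite nth_take; [congr nth; lia | lia].
Qed.

Lemma eq_take_word n c (u u' : {ffun 'I_n -> A}) :
  (forall i : 'I_n, (i < c)%N -> u i = u' i) ->
  take c (word u) = take c (word u').
Proof.
move=> e; apply: (@eq_from_nth _ 0); rewrite !size_take !size_word // => i hi.
have ic : (i < c)%N by case: ifP hi; lia.
have iN : (i < n)%N by case: ifP hi; lia.
by rewrite !nth_take // -[i]/(nat_of_ord (Ordinal iN)) !nth_word e.
Qed.

Lemma eq_drop_word n c (u u' : {ffun 'I_n -> A}) :
  (forall i : 'I_n, (c <= i)%N -> u i = u' i) ->
  drop c (word u) = drop c (word u').
Proof.
move=> e; apply: (@eq_from_nth _ 0); rewrite !size_drop !size_word // => i hi.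
have iN : (c + i < n)%N by lia.
rewrite !nth_drop -[(c + i)%N]/(nat_of_ord (Ordinal iN)) !nth_word e //=.
exact: leq_addr.
Qed.

Lemma smulw_cat (a : A) w1 w2 : smulw a (w1 ++ w2) = smulw (smulw a w1) w2.
Proof. exact: foldl_cat. Qed.

Lemma sprod_cat (w1 w2 : seq A) :
  (0 < size w1)%N -> sprod (w1 ++ w2) = smulw (sprod w1) w2.
Proof. by case: w1 => // a w1 _; apply: smulw_cat. Qed.

Lemma smul_sprod (a : A) w : (0 < size w)%N -> smul a (sprod w) = smulw a w.
Proof.
case: w => // b w _ /=; elim: w b => //= c w IH b.
by rewrite IH /= -smulA.
Qed.

Lemma smulw_sum I (r : seq I) (P : pred I) (F : I -> A) w :
  smulw (\sum_(i <- r | P i) F i) w = \sum_(i <- r | P i) smulw (F i) w.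
Proof.
elim/big_rec2: _ => [|i y z _ <-]; first exact: smulw0.
by have := smulw_linear w 1 (F i) z; rewrite !scale1r.
Qed.

Lemma smulw_homog I (r : seq I) (p : I -> bool) (v : I -> A) a s :
  a \in homog s -> (forall i, v i \in homog (p i)) ->
  smulw a (map v r) \in homog (s (+) \big[addb/false]_(i <- r) p i).
Proof.
move=> ha hv; elim: r a s ha => [|i r IH] a s ha /=.
  by rewrite big_nil addbF.
by rewrite big_cons addbA; apply: IH; apply: smul_homog.
Qed.

Lemma sprod_homog n (p : {ffun 'I_n -> bool}) (v : {ffun 'I_n -> A}) :
  (forall i, v i \in homog (p i)) ->
  sprod (word v) \in homog (\big[addb/false]_i p i).
Proof.
move=> hv; rewrite /word -big_enum /=.
case: (enum _) => [|i r]; first by rewrite homog0.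
by rewrite /= big_cons; apply: smulw_homog.
Qed.

End Words.

(** * The antibrackets and their wedges with [mu] as combinations of full symmetrizations *)

Section Expansion.
Variables (k : fieldType) (A : comSuperAlgType k) (f : {linear A -> A}).
Hypothesis char0 : [pchar k] =i pred0.

(** This is $S_j$; the division by $j!\,(N-j)!$ stays in the coefficients. *)
Definition sym_Phi N (p : {ffun 'I_N -> bool}) (v : {ffun 'I_N -> A}) j : A :=
  symmetrize p v (fun=> @Phi_term k A f N j).

Lemma PhiE N (p : {ffun 'I_N -> bool}) (v : {ffun 'I_N -> A}) :
  (forall i, v i \in homog (p i)) ->
  Phi f N v = \sum_(1 <= j < N.+1)
    ((-1) ^+ (N - j) / (j`! * (N - j)`!)%:R) *: sym_Phi p v j.
Proof.
move=> hv; rewrite /Phi symmap_sumE; apply: eq_big_nat => j /andP[_ jN].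
by rewrite symmap_scaleE (shuffle_symmetrize hv) // scalerA.
Qed.

Section Wedges.
Variables (m h : nat).

(** The outer symmetrization absorbs the inner one, so the $(m+1)!$ inner permutations contribute
    equally and cancel one factor of $(m+1)!\,h!$. The index [m] is a degree, so [m.+1] counts the
    arguments of the antibracket. *)
Lemma mu_wedge_Phi (p : {ffun 'I_(h + m).+1 -> bool})
    (v : {ffun 'I_(h + m).+1 -> A}) :
  (forall i, v i \in homog (p i)) ->
  barwedge (mu A h) (Phi f m.+1) v = \sum_(1 <= j < m.+2)
    ((-1) ^+ (m.+1 - j) / (h`! * j`! * (m.+1 - j)`!)%:R) *: sym_Phi p v j.
Proof.
move=> hv; rewrite /barwedge (shuffle_symmetrize hv) //; last by lia.
pose wq (q : {ffun 'I_(h + m).+1 -> bool}) := [ffun j : 'I_m.+1 => q (inord j)].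
pose w (u : {ffun 'I_(h + m).+1 -> A}) := [ffun j : 'I_m.+1 => u (inord j)].
pose K j (u : {ffun 'I_(h + m).+1 -> A}) (x : {ffun 'I_m.+1 -> A}) :=
  smulw (Phi_term f j x) (drop m.+1 (word u)).
pose c j : k := (-1) ^+ (m.+1 - j) / (j`! * (m.+1 - j)`!)%:R.
pose U j t q u := koszul k (wq q) t *: K j u [ffun i => w u (t i)].
rewrite (eq_symmetrize hv (U' := fun q u =>
    \sum_(1 <= j < m.+2) c j *: \sum_t U j t q u)); last first.
  move=> q u hu.
  have hw i : w u i \in homog (wq q i) by rewrite !ffunE.
  rewrite /barwedge_term /= /mu_fun word_plug /= -/(w u) (PhiE hw).
  rewrite smulw_sum; apply: eq_bigr => j _; rewrite smulwZ; congr (_ *: _).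
  rewrite /sym_Phi /symmetrize smulw_sum; apply: eq_bigr => t _.
  by rewrite smulwZ.
rewrite symmetrize_sum scaler_sumr; apply: eq_big_nat => j /andP[j0 jm].
rewrite symmetrizeZ symmetrize_sum.
have H t : symmetrize p v (U j t) = sym_Phi p v j.
  have adj (a b : 'I_m.+1) : b = a.+1 :> nat -> (b < 0)%N || (0 <= a)%N ->
      exists a' b' : 'I_(h + m).+1, [/\ b' = a'.+1 :> nat,
        forall q : {ffun 'I_(h + m).+1 -> bool},
          wq [ffun i => q (tperm a' b' i)] = [ffun i => wq q (tperm a b i)],
        forall q : {ffun 'I_(h + m).+1 -> bool},
          (wq q a && wq q b) = (q a' && q b'),
        forall u : {ffun 'I_(h + m).+1 -> A},
          w [ffun i => u (tperm a' b' i)] = [ffun i => w u (tperm a b i)] &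
        forall (u : {ffun 'I_(h + m).+1 -> A}) x,
          K j [ffun i => u (tperm a' b' i)] x = K j u x].
    move=> ab _; pose e (i : 'I_m.+1) : 'I_(h + m).+1 := inord i.
    have eE i : e i = i :> nat by rewrite inordK //; have := ltn_ord i; lia.
    have e_inj : injective e.
      by move=> i i' /(congr1 val) /=; rewrite !eE => /val_inj.
    exists (e a), (e b); split=> [|q|q|u|u x]; rewrite ?eE // ?ffunE //.
    - by apply/ffunP => i; rewrite !ffunE -[inord i]/(e i) -inj_tperm.
    - by apply/ffunP => i; rewrite !ffunE -[inord i]/(e i) -inj_tperm.
    rewrite /K; congr smulw; apply: eq_drop_word => i mi.
    have := ltn_ord a; have := ltn_ord b => hb ha.
    by rewrite ffunE tpermD // -val_eqE /= eE; lia.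
  rewrite -[t]mul1g (symmetrize_inner hv adj) ?/blockperm; last first.
    by apply/forallP => a; rewrite !ltn0.
  apply: eq_symmetrize => // q u _.
  rewrite koszul1 scale1r /K.
  have -> : [ffun i => w u ((1%g : 'S_m.+1) i)] = w u.
    by apply/ffunP => i; rewrite ffunE perm1.
  rewrite /Phi_term word_first; last by lia.
  rewrite -smulw_cat take_takel //; congr smulw.
  rewrite -[in RHS](cat_take_drop m.+1 (word u)) drop_cat.
  rewrite size_takel ?size_word; last by lia.
  case: ltnP => // e; have -> : j = m.+1 by lia.
  by rewrite subnn drop0 drop_oversize // size_takel ?size_word //; lia.
rewrite (eq_bigr _ (fun t _ => H t)) sumr_const.
rewrite -scaler_nat !scalerA card_Sn; congr (_ *: _).
have -> : ((h + m).+1 - m.+1 = h)%N by lia.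
rewrite /c; have := fact_gt0 h; have := fact_gt0 m.+1.
have := fact_gt0 j; have := fact_gt0 (m.+1 - j).
move: (m.+1 - j)`! j`! (m.+1)`! h`! => x1 x2 x3 x4.
do 4 move/(natr_neq0_pchar0 char0) => ?; rewrite !natrM; field.
by do ?[apply/andP; split].
Qed.

(** An inner permutation matters only through the place of the product of $h+1$ letters. In $j\,m!$
    cases it lies inside the argument of [f], which then has $j+h$ letters; in the other
    $(m+1-j)\,m!$ cases it lies outside and unfolds into $h+1$ single factors. *)
Lemma Phi_wedge_mu (p : {ffun 'I_(m + h).+1 -> bool})
    (v : {ffun 'I_(m + h).+1 -> A}) :
  (forall i, v i \in homog (p i)) ->
  barwedge (Phi f m.+1) (mu A h) v = \sum_(1 <= j < m.+2)
    ((-1) ^+ (m.+1 - j) / ((h.+1)`! * j`! * (m.+1 - j)`!)%:R) *: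
      (j%:R *: sym_Phi p v (j + h) + (m.+1 - j)%:R *: sym_Phi p v j).
Proof.
move=> hv; rewrite /barwedge (shuffle_symmetrize hv) //; last by lia.
pose wq (q : {ffun 'I_(m + h).+1 -> bool}) := [ffun i : 'I_m.+1 =>
  if i == ord0 then \big[addb/false]_(j < h.+1) q (inord j)
  else q (inord (h + i))].
pose w (u : {ffun 'I_(m + h).+1 -> A}) := [ffun i : 'I_m.+1 =>
  if i == ord0 then sprod (take h.+1 (word u)) else u (inord (h + i))].
have word_w u : word (w u) = sprod (take h.+1 (word u)) :: drop h.+1 (word u).
  exact: word_plug.
have size_w (u : {ffun 'I_(m + h).+1 -> A}) : size (take h.+1 (word u)) = h.+1.
  by rewrite size_takel // size_word; lia.
have hw (q : {ffun 'I_(m + h).+1 -> bool}) (u : {ffun 'I_(m + h).+1 -> A}) :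
    (forall i, u i \in homog (q i)) -> forall i, w u i \in homog (wq q i).
  move=> hu i; rewrite !ffunE; case: eqP => // _.
  rewrite -word_first; last by lia.
  have hx (j : 'I_h.+1) : [ffun j : 'I_h.+1 => u (inord j)] j \in
      homog ([ffun j : 'I_h.+1 => q (inord j)] j) by rewrite !ffunE.
  have := sprod_homog hx; congr (_ \in homog _).
  by apply: eq_bigr => j _; rewrite ffunE.
pose c j : k := (-1) ^+ (m.+1 - j) / (j`! * (m.+1 - j)`!)%:R.
pose U j t q u := koszul k (wq q) t *: Phi_term f j [ffun i => w u (t i)].
rewrite (eq_symmetrize hv (U' := fun q u =>
    \sum_(1 <= j < m.+2) c j *: \sum_t U j t q u)); last first.
  move=> q u hu.
  rewrite /barwedge_term /= /mu_fun.
  rewrite word_first; last by lia.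
  by rewrite -/(w u) (PhiE (hw q u hu)).
rewrite symmetrize_sum scaler_sumr; apply: eq_big_nat => j /andP[j0 jm].
rewrite symmetrizeZ symmetrize_sum.
(* The block bound $1$ keeps letter 0, the product, in place; the other letters of [w u] are single
   letters of [u]. *)
have adj (a b : 'I_m.+1) : b = a.+1 :> nat -> (b < 1)%N || (1 <= a)%N ->
    exists a' b' : 'I_(m + h).+1, [/\ b' = a'.+1 :> nat,
      forall q : {ffun 'I_(m + h).+1 -> bool},
        wq [ffun i => q (tperm a' b' i)] = [ffun i => wq q (tperm a b i)],
      forall q : {ffun 'I_(m + h).+1 -> bool},
        (wq q a && wq q b) = (q a' && q b'),
      forall u : {ffun 'I_(m + h).+1 -> A},
        w [ffun i => u (tperm a' b' i)] = [ffun i => w u (tperm a b i)] &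
      forall (u : {ffun 'I_(m + h).+1 -> A}) (x : {ffun 'I_m.+1 -> A}),
        Phi_term f j x = Phi_term f j x].
  move=> ab; rewrite ab /= => a0.
  pose e (i : 'I_m.+1) : 'I_(m + h).+1 := inord (h + i).
  have eE i : e i = (h + i)%N :> nat.
    by rewrite inordK //; have := ltn_ord i; lia.
  have e_inj : injective e.
    by move=> i i' /(congr1 val) /=; rewrite !eE => /addnI/val_inj.
  have na : a != ord0 by rewrite -val_eqE /=; lia.
  have nb : b != ord0 by rewrite -val_eqE /= ab.
  have t0 i : (tperm a b i == ord0) = (i == ord0).
    by case: tpermP => [->|->|//]; rewrite (negbTE na) (negbTE nb).
  have fixed (i : 'I_(m + h).+1) : (i < h.+1)%N -> tperm (e a) (e b) i = i.
    by move=> ih; rewrite tpermD // -val_eqE /= eE; lia.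
  exists (e a), (e b); split=> [|q|q|u|//]; rewrite ?eE ?ab ?addnS //.
  - apply/ffunP => i; rewrite !ffunE t0; case: ifP => _.
      apply: eq_bigr => l _; have := ltn_ord l => hl.
      by rewrite ffunE fixed // inordK; lia.
    by rewrite -[inord _]/(e i) -inj_tperm.
  - by rewrite !ffunE (negbTE na) (negbTE nb).
  apply/ffunP => i; rewrite !ffunE t0; case: ifP => _.
    by congr sprod; apply: eq_take_word => l /fixed e1; rewrite ffunE e1.
  by rewrite -[inord _]/(e i) -inj_tperm.
(* The two invariances of [H] below reduce it to two values, according to
   whether the letter 0 of [w u], the product, lands in the first [j] places. *)
pose H t := symmetrize p v (U j t).
have Hr t y : blockperm 1 y -> H (t * y)%g = H t.
  move=> yb.
  exact: (symmetrize_inner (K := fun=> @Phi_term k A f m.+1 j) hv adj t yb).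
(* Here places are permuted within the two blocks of [Phi_term], which is supersymmetric in each. *)
have Hl t y : blockperm j y -> H (y * t)%g = H t.
  move=> yb; apply: eq_symmetrize => // q u hu.
  have inv := block_adj_inv (@Phi_term_sym k A f m.+1 j) (hw q u hu).
  exact: adj_inv_blockperm inv yb.
have H1 : H 1%g = sym_Phi p v (j + h).
  apply: eq_symmetrize => // q u _.
  rewrite /U koszul1 scale1r.
  have -> : [ffun i => w u ((1%g : 'S_m.+1) i)] = w u.
    by apply/ffunP => i; rewrite ffunE perm1.
  rewrite /Phi_term word_w -[in RHS](cat_take_drop h.+1 (word u)).
  rewrite take_cat drop_cat size_w; case: ltnP => [|_]; first by lia.
  have -> : (j + h - h.+1 = j.-1)%N by lia.
  rewrite sprod_cat ?size_w //.
  by case: (j) j0 => // j' _.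
(* Rotating [w u] by one letter puts the product last. This matches rotating [u] by $h+1$ letters,
   with the same sign since the parity of the product is the sum of the parities, and associativity
   unfolds the last factor. *)
have Hrot : (j <= m)%N -> H (rot_perm (ltn0Sn m)) = sym_Phi p v j.
  move=> jm'; have hN : (h.+1 <= (m + h).+1)%N by lia.
  apply: (symmetrize_perm hv (t := rot_perm hN)) => // q u hu.
  rewrite /U !koszul_rot; congr (_ ^+ nat_of_bool (_ && _) *: _).
  - rewrite big_nat1 ffunE -val_eqE /= inordK // eqxx.
    by rewrite big_mkord.
  - rewrite -[h.+1]add1n big_addn subSn ?leq_addl // addnK.
    apply: eq_big_nat => i /andP[i0 im].
    rewrite ffunE -val_eqE /= inordK // ifN; last by lia.
    by rewrite (addnC h i).
  have size_D : size (drop h.+1 (word u)) = m.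
    by rewrite size_drop size_word; lia.
  rewrite /Phi_term !word_rot word_w /rot /= drop0 take0 !takel_cat ?size_D //.
  have catD l : drop j (drop h.+1 (word u) ++ l) =
      drop j (drop h.+1 (word u)) ++ l.
    rewrite drop_cat size_D; case: ltnP => // mj.
    have -> : j = m by lia.
    by rewrite subnn drop0 drop_oversize // size_D.
  by rewrite !catD !smulw_cat /= smul_sprod // size_w.
have fix0 (t : 'S_m.+1) : t ord0 = ord0 -> blockperm 1 t.
  move=> t0; apply/forallP => a; rewrite !ltnS !leqn0.
  rewrite -[t a == 0%N :> nat]/(t a == ord0) -[a == 0%N :> nat]/(a == ord0).
  by rewrite -{1}t0 (inj_eq perm_inj).
have tpermj (a b : 'I_m.+1) : (a < j)%N = (b < j)%N -> blockperm j (tperm a b).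
  by move=> ab; apply/forallP => i; case: tpermP => [->|->|_ _]; rewrite ?ab.
(* Within its block the product is moved to the first or to the last place. What then remains, up to
   the rotation in the second case, fixes letter 0 and is absorbed by [Hr]. *)
have H0 (t : 'S_m.+1) (i : 'I_m.+1) : t i = ord0 ->
    H t = if (i < j)%N then sym_Phi p v (j + h) else sym_Phi p v j.
  move=> ti; case: ltnP => ij.
    rewrite -(Hl t (tperm ord0 i)); last by apply: tpermj; rewrite ij j0.
    rewrite -[(tperm _ _ * t)%g]mul1g Hr //.
    by apply: fix0; rewrite permM tpermL.
  have jm' : (j <= m)%N by have := ltn_ord i; lia.
  rewrite -(Hl t (tperm ord_max i)); last first.
    by apply: tpermj => /=; rewrite !ltnNge ij jm'.
  set s := (_ * t)%g; rewrite -[s](mulKVg (rot_perm (ltn0Sn m))) Hr ?Hrot //.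
  apply: fix0; rewrite permM.
  have -> : (rot_perm (ltn0Sn m))^-1%g ord0 = ord_max.
    apply/(canLR (permK _))/val_inj; rewrite /= permE rot_ordE //=.
    by rewrite addn1 ltnn subnn.
  by rewrite permM tpermL.
have -> : \sum_t H t =
    m`!%:R *: (j%:R *: sym_Phi p v (j + h) + (m.+1 - j)%:R *: sym_Phi p v j).
  pose F (i : nat) :=
    if (i < j)%N then sym_Phi p v (j + h) else sym_Phi p v j.
  transitivity (\sum_(i < m.+1) F i *+ m`!).
    (* The permutations are sorted by the place of the product; each place occurs $m!$ times. *)
    rewrite (partition_big (fun t : 'S_m.+1 => t^-1%g ord0) predT) //=.
    apply: eq_bigr => i _; rewrite -[m`!](card_perm_maps i ord0) -sumr_const.
    apply: eq_big => [t|t /eqP ti]; last first.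
      by apply: (H0 t i); rewrite -ti permKV.
    by rewrite inE; apply/eqP/eqP => <-; rewrite ?permK ?permKV.
  rewrite sumrMnl -scaler_nat; congr (_ *: _).
  rewrite -(big_mkord xpredT F) (@big_cat_nat _ _ _ j) //=.
  congr (_ + _).
    rewrite (eq_big_nat _ _ (F2 := fun=> sym_Phi p v (j + h))).
      by rewrite sumr_const_nat subn0 scaler_nat.
    by move=> i /andP[_ ij]; rewrite /F ij.
  rewrite (eq_big_nat _ _ (F2 := fun=> sym_Phi p v j)).
    by rewrite sumr_const_nat scaler_nat.
  by move=> i /andP[ij _]; rewrite /F ltnNge ij.
rewrite !scalerA; congr (_ *: _).
have -> : ((m + h).+1 - h.+1 = m)%N by lia.
rewrite /c; have := fact_gt0 h.+1; have := fact_gt0 m.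
have := fact_gt0 j; have := fact_gt0 (m.+1 - j).
move: (m.+1 - j)`! j`! m`! (h.+1)`! => x1 x2 x3 x4.
do 4 move/(natr_neq0_pchar0 char0) => ?; rewrite !natrM; field.
by do ?[apply/andP; split].
Qed.

End Wedges.
End Expansion.

(** * Reduction to homogeneous arguments, additivity, and brackets of single components *)

Section Brackets.
Variables (k : fieldType) (V : superModType k).

(** Induction on a list containing all indices whose entries may fail to be homogeneous: linearity
    splits one such entry into its even and odd components. *)
Lemma symmap_ext_homog n (f g : symmap V n) :
  (forall (p : {ffun 'I_n -> bool}) (v : {ffun 'I_n -> V}),
     (forall i, v i \in homog (p i)) -> f v = g v) -> f = g.
Proof.
move=> fg; apply: symmap_ext => v.
have : forall i, i \notin enum 'I_n -> exists s, v i \in homog s.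
  by move=> i; rewrite mem_enum.
elim: (enum _) v => [|i r IH] v hv.
  apply: (fg [ffun i => v i \in homog true]) => i; rewrite ffunE.
  by case: (boolP (v i \in homog true)) => // nh; have [//|[] hi] := hv i;
    rewrite ?hi in nh.
have -> : v = upd v i (1 *: superpart false (v i) + superpart true (v i)).
  apply/ffunP => l; rewrite ffunE scale1r -superpart_split.
  by case: eqP => // ->.
rewrite !symmap_multilinear; congr (_ *: _ + _); apply: IH => l lr;
  rewrite ffunE; case: eqVneq => li; try (by eexists; apply: superpart_homog);
  by apply: hv; rewrite inE negb_or li.
Qed.

Lemma sympartE n s (f : symmap V n) (p : {ffun 'I_n -> bool})
    (v : {ffun 'I_n -> V}) : (forall i, v i \in homog (p i)) ->
  sympart s f v = superpart (s (+) \big[addb/false]_(i < n) p i) (f v).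
Proof.
move=> hv; rewrite /= /sympart_fun (homog_extendE _ hv) // => q.
by apply: multilinear_comp; apply: symmap_multilinear.
Qed.

Lemma sympart_split n (f : symmap V n) :
  f = sympart true f + sympart false f.
Proof.
apply: symmap_ext_homog => p v hv; rewrite symmap_addE !(sympartE _ _ hv) /=.
by rewrite [LHS]superpart_split; case: (\big[_/_]_i _); rewrite // addrC.
Qed.

Lemma sympart0 n s : sympart s (0 : symmap V n) = 0.
Proof.
by apply: symmap_ext_homog => p v hv; rewrite (sympartE _ _ hv) linear0.
Qed.

Lemma barwedgeE n m (f : superD V n) (g : superD V m)
    (p : {ffun 'I_(n + m).+1 -> bool}) (v : {ffun 'I_(n + m).+1 -> V}) :
  (forall i, v i \in homog (p i)) ->
  barwedge f g v = \sum_(s in shuffles (n + m).+1 m.+1)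
    koszul k p s *: barwedge_term f g [ffun i => v (s i)].
Proof.
move=> hv; rewrite /= /shuffle_sum (homog_extendE _ hv) // => q.
apply: multilinear_sum => s; apply: multilinear_scale.
exact/multilinear_perm/barwedge_term_multilinear.
Qed.

Lemma barwedgeDl n m (f1 f2 : superD V n) (g : superD V m) :
  barwedge (f1 + f2) g = barwedge f1 g + barwedge f2 g.
Proof.
apply: symmap_ext_homog => p v hv.
rewrite symmap_addE !(barwedgeE _ _ hv) -big_split; apply: eq_bigr => s _ /=.
by rewrite -scalerDr.
Qed.

Lemma barwedgeDr n m (f : superD V n) (g1 g2 : superD V m) :
  barwedge f (g1 + g2) = barwedge f g1 + barwedge f g2.
Proof.
apply: symmap_ext_homog => p v hv.
rewrite symmap_addE !(barwedgeE _ _ hv) -big_split; apply: eq_bigr => s _ /=.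
rewrite -scalerDr; congr (_ *: _); set u := finfun _.
pose x : {ffun 'I_n.+1 -> V} := [ffun i : 'I_n.+1 => u (inord (m + i))].
have termE (g : superD V m) : barwedge_term f g u =
    f (upd x ord0 (g [ffun j : 'I_m.+1 => u (inord j)])).
  congr (f _); apply/ffunP => i; rewrite !ffunE; case: eqP => // _.
by rewrite !termE symmap_addE -[X in X + _]scale1r symmap_multilinear scale1r.
Qed.

Lemma barwedge0l n m (g : superD V m) : barwedge (0 : superD V n) g = 0.
Proof. by apply/(addrI (barwedge 0 g)); rewrite -barwedgeDl !addr0. Qed.

Lemma barwedge0r n m (f : superD V n) : barwedge f (0 : superD V m) = 0.
Proof. by apply/(addrI (barwedge f 0)); rewrite -barwedgeDr !addr0. Qed.

Lemma ecast0 n m (e : n = m) : ecast i (superD V i) e 0 = 0.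
Proof. by case: m / e. Qed.

Lemma ecastD n m (e : n = m) (f g : superD V n) :
  ecast i (superD V i) e (f + g) =
  ecast i (superD V i) e f + ecast i (superD V i) e g.
Proof. by case: m / e. Qed.

Lemma NRbracket0l n m (g : superD V m) : NRbracket (0 : superD V n) g = 0.
Proof.
rewrite /NRbracket big1 // => s _; rewrite big1 // => t _.
by rewrite sympart0 barwedge0l barwedge0r ecast0 scaler0 subr0.
Qed.

Lemma NRbracket0r n m (f : superD V n) : NRbracket f (0 : superD V m) = 0.
Proof.
rewrite /NRbracket big1 // => s _; rewrite big1 // => t _.
by rewrite sympart0 barwedge0l barwedge0r ecast0 scaler0 subr0.
Qed.

(** For even [f] all signs are $1$, and the two components of [g] recombine by additivity. This is
    the case of [mu]. *)
Lemma NRbracket_even n m (f : superD V n) (g : superD V m) :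
  sympart true f = 0 ->
  NRbracket f g =
    barwedge f g - ecast i (superD V i) (addnC m n) (barwedge g f).
Proof.
move=> f1; have f0 : sympart false f = f by rewrite [RHS]sympart_split f1 add0r.
rewrite /NRbracket !big_bool /= f0 f1 !barwedge0l !barwedge0r !ecast0 !scaler0.
rewrite subr0 !add0r !scale1r addrACA -opprD -ecastD -barwedgeDl -barwedgeDr.
by rewrite -sympart_split.
Qed.

Lemma inD_cast n N (e : n = N) (f : superD V n) :
  inD f N = ecast i (superD V i) e f.
Proof.
by case: N / e; rewrite /inD; case: eqP => // e; rewrite (eq_axiomK e).
Qed.

Lemma inD_id n (f : superD V n) : inD f n = f.
Proof. exact: (inD_cast erefl). Qed.

Lemma inD_neq n N (f : superD V n) : n <> N -> inD f N = 0.
Proof. by rewrite /inD; case: eqP. Qed.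

(** In each degree only the summand with index [n] can be nonzero. *)
Lemma bracket_inD n m (f : superD V n) (g : superD V m) :
  bracket (inD f) (inD g) = inD (NRbracket f g).
Proof.
apply: functional_extensionality_dep => N; rewrite /bracket.
(* With [m'] and the proof [e] arbitrary, [N] can be eliminated and the cast disappears. *)
have main m' (e : (n + m')%N = N) :
    ecast j (superD V j) e (NRbracket f (inD g m')) = inD (NRbracket f g) N.
  case: N / e; have [<-|nm] := eqVneq m m'; first by rewrite !inD_id.
  rewrite !inD_neq ?NRbracket0r //; last exact/eqP.
  by move/addnI/eqP; apply/negP.
have [nN|Nn] := leqP n N; last first.
  rewrite inD_neq; last by lia.
  rewrite big1 // => i _; rewrite (inD_neq (N := i)).
    by rewrite NRbracket0l ecast0.
  by have := ltn_ord i; lia.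
pose i0 : 'I_N.+1 := Ordinal (nN : (n < N.+1)%N).
rewrite (bigD1 i0) //= big1 ?addr0 => [|i ni].
  by rewrite inD_id; apply: main.
rewrite (inD_neq (N := i)) ?NRbracket0l ?ecast0 // => e.
by case/eqP: ni; apply: val_inj.
Qed.

Lemma Dprod_sumE I r (P : pred I) (F : I -> superDprod V) N :
  (\sum_(i <- r | P i) F i) N = \sum_(i <- r | P i) F i N.
Proof. by elim/big_rec2: _ => // i y g _ <-. Qed.

End Brackets.

(** Pascal's rule $\binom{j}{h+1}=\binom{j-1}{h}+\binom{j-1}{h+1}$ makes the sum telescope. The
    upper end vanishes and the lower one gives $r+(j-1)=n$. *)
Lemma sum_bin_antibracket (R : comPzRingType) (r j n : nat) :
  (0 < j)%N -> (r + j = n.+1)%N ->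
  \sum_(1 <= h < n.+1) ('C(r, h)%:R - 'C(r, h.+1)%:R
     - (-1) ^+ h * 'C(j, h.+1)%:R) = n%:R :> R.
Proof.
case: j => // j _ rj.
pose F h : R := - ('C(r, h)%:R - (-1) ^+ h * 'C(j, h)%:R).
transitivity (\sum_(1 <= h < n.+1) (F h.+1 - F h)).
  apply: eq_bigr => h _; rewrite /F binS natrD exprS; ring.
rewrite telescope_sumr // /F !bin1 (@bin_small r) ?(@bin_small j); try lia.
have -> : n = (r + j)%N by lia.
by rewrite natrD mulr0 expr1; ring.
Qed.

(** * The coefficients of the bracket of [mu] with an antibracket *)

Section Main.
Variables (k : fieldType) (A : comSuperAlgType k) (f : {linear A -> A}).
Hypothesis char0 : [pchar k] =i pred0.

Let natr_bin a b :
  'C(a + b, a)%:R = (a + b)`!%:R / (a`! * b`!)%:R :> k.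
Proof.
apply: (canRL (mulfK _)).
  by rewrite (natr_neq0_pchar0 char0) // muln_gt0 !fact_gt0.
by rewrite -natrM -{2}(addKn a b) bin_fact // leq_addr.
Qed.

Lemma sympart_mu n : sympart true (mu A n) = 0.
Proof.
apply: symmap_ext_homog => p v hv; rewrite (sympartE _ _ hv) /=.
rewrite (superpart_neq (sprod_homog hv)) //.
by case: (\big[_/_]_i _).
Qed.

(** Both wedge expansions are brought to the coefficients of $\Phi^{n+1}_f$ times binomials, over a
    range of [j] that does not depend on [h], so that the sums over [h] and [j] can later be
    exchanged. *)
Lemma NR_mu_Phi h m n (e : (h + m)%N = n) (p : {ffun 'I_n.+1 -> bool})
    (v : {ffun 'I_n.+1 -> A}) : (0 < h)%N ->
  (forall i, v i \in homog (p i)) ->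
  (-1) ^+ h *: (ecast i (superD A i) e (NRbracket (mu A h) (Phi f m.+1))) v =
  \sum_(1 <= j < n.+2) ((-1) ^+ (n.+1 - j) / (j`! * (n.+1 - j)`!)%:R *
     ('C(n.+1 - j, h)%:R - 'C(n.+1 - j, h.+1)%:R
      - (-1) ^+ h * 'C(j, h.+1)%:R)) *: sym_Phi f p v j.
Proof.
move=> h0 hv; have e' : (m + h)%N = n by rewrite addnC.
(* The two wedges have degrees [h + m] and [m + h]. Eliminating [n] removes only one of the casts,
   so the other is evaluated beforehand. *)
have castE : (ecast i (superD A i) e' (barwedge (Phi f m.+1) (mu A h))) v =
  \sum_(1 <= j < m.+2)
    ((-1) ^+ (m.+1 - j) / ((h.+1)`! * j`! * (m.+1 - j)`!)%:R) *:
      (j%:R *: sym_Phi f p v (j + h) + (m.+1 - j)%:R *: sym_Phi f p v j).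
  by clear e; case: n / e' p v hv => p v hv; apply: Phi_wedge_mu.
case: n / e p v hv e' castE => p v hv e' castE /=.
rewrite (NRbracket_even _ (sympart_mu h)) symmap_addE symmap_oppE.
rewrite (eq_irrelevance (addnC m h) e') castE (mu_wedge_Phi f char0 hv).
pose s j : k := (-1) ^+ ((h + m).+1 - j) / (j`! * ((h + m).+1 - j)`!)%:R.
have signE j : (j <= m.+1)%N ->
    (-1) ^+ ((h + m).+1 - j) = (-1) ^+ h * (-1) ^+ (m.+1 - j) :> k.
  by move=> jm; rewrite -exprD; congr (_ ^+ _); lia.
rewrite scalerBr !scaler_sumr.
rewrite [X in _ - X](eq_big_nat _ _ (F2 := fun j =>
    (s (j + h)%N * ((-1) ^+ h * 'C(j + h, h.+1)%:R)) *: sym_Phi f p v (j + h) +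
    (s j * 'C((h + m).+1 - j, h.+1)%:R) *: sym_Phi f p v j)); last first.
  move=> j /andP[j0 jm]; rewrite ltnS in jm.
  rewrite scalerDr !scalerA scalerDr !scalerA /s (signE j) //.
  have -> : ((h + m).+1 - (j + h) = m.+1 - j)%N by lia.
  have -> : ((h + m).+1 - j = h + (m.+1 - j))%N by lia.
  move: (m.+1 - j)%N => r; congr (_ *: _ + _ *: _).
    case: j j0 {jm} => // j _; rewrite addSnnS addnC natr_bin (factS j).
    have := (natr_neq0_pchar0 char0) (ltn0Sn j); have := fact_gt0 (h.+1 + j).
    have := fact_gt0 j; have := fact_gt0 r; have := fact_gt0 h.+1.
    move: (h.+1 + j)`! j.+1 j`! r`! (h.+1)`! => x1 x2 x3 x4 x5.
    do 4 move/(natr_neq0_pchar0 char0)=> ?; move=> ?; rewrite !natrM; field.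
    by do ?[apply/andP; split].
  (* For [r] zero both sides vanish, since $\binom{h}{h+1}=0$. *)
  case: r => [|r]; first by rewrite addn0 bin_small // !mulr0.
  rewrite -addSnnS natr_bin (factS r).
  have := (natr_neq0_pchar0 char0) (ltn0Sn r); have := fact_gt0 (h.+1 + r).
  have := fact_gt0 r; have := fact_gt0 j; have := fact_gt0 h.+1.
  move: (-1) (h.+1 + r)`! r.+1 r`! j`! (h.+1)`! => e1 x1 x2 x3 x4 x5.
  do 4 move/(natr_neq0_pchar0 char0)=> ?; move=> ?; rewrite !natrM; field.
  by do ?[apply/andP; split].
rewrite big_split /=.
(* After the shift by [h] the range starts at $h+1$; the added terms $j\le h$ vanish as
   $\binom{j}{h+1}=0$. *)
have -> : \sum_(1 <= j < m.+2)
    (s (j + h)%N * ((-1) ^+ h * 'C(j + h, h.+1)%:R)) *: sym_Phi f p v (j + h) =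
  \sum_(1 <= j < (h + m).+2)
    (s j * ((-1) ^+ h * 'C(j, h.+1)%:R)) *: sym_Phi f p v j.
  rewrite [RHS](@big_cat_nat _ _ _ h.+1) //=; last by lia.
  rewrite [X in _ = X + _](_ : _ = 0) ?add0r; last first.
    rewrite big_nat big1 // => j /andP[_ jh].
    by rewrite bin_small // !mulr0 scale0r.
  rewrite -[in RHS](add1n h) big_addn.
  by have -> : ((h + m).+2 - h = m.+2)%N by lia.
(* For $j>m+1$ fewer than [h] letters remain, so both binomials in $h+m+1-j$ are zero. *)
have ext (F : nat -> k) : (forall j, (m.+1 < j)%N -> F j = 0) ->
    \sum_(1 <= j < m.+2) F j *: sym_Phi f p v j =
    \sum_(1 <= j < (h + m).+2) F j *: sym_Phi f p v j.
  move=> F0; rewrite [RHS](@big_cat_nat _ _ _ m.+2) //=; last by lia.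
  rewrite [X in _ = _ + X](_ : _ = 0) ?addr0 // big_nat big1 // => j.
  by case/andP=> jm _; rewrite F0 ?scale0r.
rewrite (eq_big_nat _ _ (F2 := fun j =>
    (s j * 'C((h + m).+1 - j, h)%:R) *: sym_Phi f p v j)); last first.
  move=> j /andP[j0 jm]; rewrite ltnS in jm.
  rewrite !scalerA /s (signE j) //.
  have -> : ((h + m).+1 - j = h + (m.+1 - j))%N by lia.
  move: (m.+1 - j)%N => r; congr (_ *: _); rewrite natr_bin.
  have := fact_gt0 (h + r); have := fact_gt0 r; have := fact_gt0 j.
  have := fact_gt0 h; move: (h + r)`! r`! j`! h`! => x1 x2 x3 x4.
  do 4 move/(natr_neq0_pchar0 char0)=> ?; rewrite !natrM; field.
  by do ?[apply/andP; split].
rewrite !ext; first last.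
- by move=> j jm; rewrite bin_small ?mulr0 //; lia.
- by move=> j jm; rewrite bin_small ?mulr0 //; lia.
rewrite opprD addrCA -sumrB addrC -sumrB; apply: eq_bigr => j _.
by rewrite -!scalerBl -!mulrBr.
Qed.

End Main.

Theorem corollary2p2 (k : fieldType) (char0 : [pchar k] =i pred0)
    (A : comSuperAlgType k) (f : {linear A -> A}) :
  (forall v : {ffun 'I_1 -> A}, Phi f 1 v = f (v ord0)) /\
  (forall n : nat, (1 <= n)%N ->
     inD (Phi f n.+1) =
       n%:R^-1 *: \sum_(1 <= h < n.+1)
         (-1) ^+ h *: rho h (inD (Phi f (n - h).+1)) /\
     inD (Phi f n.+1) =
       n%:R^-1 *: \sum_(1 <= h < n.+1)
         (-1) ^+ h *: inD (NRbracket (mu A h) (Phi f (n - h).+1))).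
Proof.
split.
  (* The expansion [PhiE] needs homogeneous arguments. Packaging [f] as a [symmap] lets
     [symmap_ext_homog] reach arbitrary ones. *)
  have Flin : multilinear (fun v : {ffun 'I_1 -> A} => f (v ord0)).
    by move=> v i a x y; rewrite !ffunE (ord1 i) eqxx linearP.
  have perm_1 (s : 'S_1) : s = 1%g.
    by apply/permP => i; rewrite !ord1.
  have Fsym : supersymmetric (fun v : {ffun 'I_1 -> A} => f (v ord0)).
    by move=> p v hv s; rewrite (perm_1 s) koszul1 scale1r ffunE perm1.
  suff -> : Phi f 1 = Symmap Flin Fsym by [].
  apply: symmap_ext_homog => p v hv; rewrite (PhiE f char0 hv) big_nat1 /=.
  rewrite /sym_Phi /symmetrize (bigD1 1%g) //= big1 => [|s]; last first.
    by rewrite (perm_1 s) eqxx.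
  rewrite koszul1 scale1r addr0 subnn expr0 (_ : (1`! * 0`!)%:R = 1) //.
  rewrite divr1 scale1r.
  have -> : [ffun i => v ((1%g : 'S_1) i)] = v.
    by apply/ffunP => i; rewrite ffunE perm1.
  rewrite /Phi_term (@word_eq _ _ _ v [:: v ord0]) // => i.
  by rewrite (ord1 i).
move=> n n0.
suff main : inD (Phi f n.+1) = n%:R^-1 *: \sum_(1 <= h < n.+1)
    (-1) ^+ h *: inD (NRbracket (mu A h) (Phi f (n - h).+1)).
  split=> //; rewrite main; congr (_ *: _); apply: eq_bigr => h _.
  by rewrite /rho bracket_inD.
apply: functional_extensionality_dep => N.
rewrite -[RHS]/(_ *: ((\sum_(1 <= h < n.+1) _) : superDprod A) N) Dprod_sumE.
rewrite -[LHS]/(inD _ N).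
have [<-|nN] := eqVneq n N; last first.
  rewrite inD_neq; last exact/eqP.
  rewrite big_nat big1 ?scaler0 // => h /andP[h0 hn].
  rewrite -[LHS]/(_ *: inD _ N) inD_neq ?scaler0 // subnKC //.
  exact/eqP.
rewrite inD_id; apply: symmap_ext_homog => p v hv.
rewrite symmap_scaleE symmap_sumE (PhiE f char0 hv).
rewrite [X in _ = _ *: X](eq_big_nat _ _ (F2 := fun h => \sum_(1 <= j < n.+2)
   ((-1) ^+ (n.+1 - j) / (j`! * (n.+1 - j)`!)%:R *
     ('C(n.+1 - j, h)%:R - 'C(n.+1 - j, h.+1)%:R
      - (-1) ^+ h * 'C(j, h.+1)%:R)) *: sym_Phi f p v j)); last first.
  move=> h /andP[h0 hn].
  have e : (h + (n - h) = n)%N by lia.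
  by rewrite -(NR_mu_Phi f char0 e h0 hv) -inD_cast.
(* For each [j] the binomial factors sum over [h] to [n], which cancels the factor $1/n$. *)
rewrite exchange_big scaler_sumr; apply: eq_big_nat => j /andP[j0 jn] /=.
rewrite -scaler_suml -mulr_sumr sum_bin_antibracket //; last by lia.
rewrite scalerA mulrCA mulVf ?mulr1 //.
exact: natr_neq0_pchar0.
Qed.
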